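(* Let $N \ge 2$ and $1^* = \frac{N}{N-1}$. Suppose there exist $R > 0$, $1 \leq q < 1^*$ and a bounded sequence $(u_n)$ in $BV(\mathbb{R}^N)$ such that $$\sup_{y \in \mathbb{R}^N}\int_{B_R(y)}|u_n|^q\,dx \to 0 \quad \text{as } n \to \infty.$$ Then $u_n \to 0$ in $L^s(\mathbb{R}^N)$ for all $s \in (1,1^* )$.
   Context: $BV(\mathbb{R}^N)$ is the space of functions of bounded variation: all $u \in L^1(\mathbb{R}^N)$ whose distributional derivative $Du$ is a (finite) vector-valued Radon measure, equivalently $$\int_{\mathbb{R}^N}|Du| := \sup\left\{\int_{\mathbb{R}^N} u\,\mathrm{div}\,\phi\,dx : \phi \in C^1_c(\mathbb{R}^N,\mathbb{R}^N),\ |\phi|_\infty \le 1\right\} < +\infty.$$ It is a Banach space with the norm $\|u\| = \int_{\mathbb{R}^N}|Du| + \int_{\mathbb{R}^N}|u|\,dx$; ''bounded in $BV(\mathbb{R}^N)$'' refers to this norm. $B_R(y)$ is the open ball of radius $R$ centred at $y$. *)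

(* Defs.v *)
From HB Require Import structures.
From mathcomp Require Import all_boot all_order all_algebra.
From mathcomp Require Import lra.
From mathcomp Require Import all_classical all_reals all_analysis.

Set Implicit Arguments.
Unset Strict Implicit.
Unset Printing Implicit Defensive.

Import Order.TTheory GRing.Theory Num.Theory.
Import numFieldNormedType.Exports.

Local Open Scope classical_set_scope.
Local Open Scope ring_scope.

(* R^n is 'rV[R]_n. Its library norm is the sup norm, so the Euclidean norm and
   the Euclidean balls are introduced below; the topology is the usual one.   *)

Section borel_rV.
Context {R : realType} {n : nat}.

Definition rV_borel : set (set 'rV[R]_n) := <<s @open 'rV[R]_n >>.

Let rV_borel0 : rV_borel set0.
Proof. exact: sigma_algebra0. Qed.

Let rV_borelC A : rV_borel A -> rV_borel (~` A).
Proof. exact: sigma_algebraC. Qed.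

Let rV_borel_bigcup (F : (set 'rV[R]_n)^nat) :
  (forall i, rV_borel (F i)) -> rV_borel (\bigcup_i F i).
Proof. exact: sigma_algebra_bigcup. Qed.

HB.instance Definition _ := @isMeasurable.Build default_measure_display
  'rV[R]_n rV_borel rV_borel0 rV_borelC rV_borel_bigcup.

End borel_rV.

Section rV_measurability.
Context {R : realType}.

Lemma open_measurable_rV n (A : set 'rV[R]_n) : open A -> measurable A.
Proof. by move=> oA; exact: sub_sigma_algebra. Qed.

Lemma measurable_rV_coord n (i : 'I_n) :
  measurable_fun [set: 'rV[R]_n] (fun v => v ord0 i).
Proof.
apply: (measurability _ (measurable_realfun.RGenOpens.measurableE R)).
move=> _ [_ [a [b ->]] <-]; rewrite setTI; apply: open_measurable_rV.
by apply: open_comp; [move=> v _; exact: coord_continuous|exact: interval_open].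
Qed.

Let box n (c : {ffun 'I_n -> rat * rat}) : set 'rV[R]_n :=
  [set v | forall i, ratr (c i).1 < v ord0 i < ratr (c i).2].

Let open_box n (A : set 'rV[R]_n) : open A ->
  A = \bigcup_c (if `[< box (n := n) c `<=` A >] then box c else set0).
Proof.
move=> oA; apply/seteqP; split=> [x Ax|x [c _]]; last first.
  by case: ifPn => // /asboolP cA /cA.
have /nbhs_ballP[e /= e0 xeA] : nbhs x A by move: oA; rewrite openE; exact.
have cE i : {p : rat * rat | (x ord0 i - e < ratr p.1 < x ord0 i) /\
    (x ord0 i < ratr p.2 < x ord0 i + e)}.
  apply: cid.
  have [|a] := @rat_in_itvoo R (x ord0 i - e) (x ord0 i).
    by rewrite ltrBlDr ltrDl.
  have [|b] := @rat_in_itvoo R (x ord0 i) (x ord0 i + e).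
    by rewrite ltrDl.
  by rewrite !in_itv/= => xb ax; exists (a, b).
exists [ffun i => projT1 (cE i)] => //; case: ifPn => [_ i|/asboolP].
  by rewrite ffunE; case: cE => /= p [/andP[_ ->] /andP[->]].
case => v xv; apply: xeA; split => // i j; rewrite !ord1.
have := xv j; rewrite ffunE; case: (cE j) => /= p.
move=> [/andP[a1 a2] /andP[b1 b2]] /andP[va vb].
by rewrite /ball/= ltr_distl; apply/andP; split; lra.
Qed.

Lemma measurable_fun_rV d (T : measurableType d) n (f : T -> 'rV[R]_n) :
  (forall i, measurable_fun [set: T] (fun t => f t ord0 i)) ->
  measurable_fun [set: T] f.
Proof.
move=> mf; apply: (@measurability _ _ _ _ _ _ (@open 'rV[R]_n)) => //.
move=> _ [A oA <-]; rewrite setTI (open_box oA) preimage_bigcup.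
apply: countable_bigcupT_measurable; first exact: countableP.
move=> c; case: ifPn => _; last by rewrite preimage_set0.
rewrite (_ : _ @^-1` _ = \bigcap_(i in [set: 'I_n])
    ((fun t => f t ord0 i) @^-1` `]ratr (c i).1, ratr (c i).2[)); last first.
  apply/seteqP; split=> t /= h i; first by move=> _; rewrite /= in_itv/=; exact: h.
  by have := h i I; rewrite /= in_itv.
apply: fin_bigcap_measurable; [exact: finite_finset|move=> i _].
rewrite -[X in measurable X]setTI.
by apply: mf => //; exact: measurable_itv.
Qed.

End rV_measurability.

Section lebesgue_rV.
Context {R : realType}.

Definition rVcons n (p : measurableTypeR R * 'rV[R]_n) : 'rV[R]_n.+1 :=
  \row_(i < n.+1) if unlift ord0 i is Some j then p.2 ord0 j else p.1.

Let rVuncons n (v : 'rV[R]_n.+1) : measurableTypeR R * 'rV[R]_n :=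
  (v ord0 ord0, \row_(i < n) v ord0 (lift ord0 i)).

Lemma rVcons0 n p : @rVcons n p ord0 ord0 = p.1.
Proof. by rewrite mxE unlift_none. Qed.

Lemma rVconsS n p i : @rVcons n p ord0 (lift ord0 i) = p.2 ord0 i.
Proof. by rewrite mxE liftK. Qed.

Let rVconsK n : cancel (@rVcons n) (@rVuncons n).
Proof.
move=> [x v]; rewrite /rVuncons rVcons0; congr (_, _).
by apply/rowP => i; rewrite mxE rVconsS.
Qed.

Lemma measurable_rVcons n : measurable_fun [set: _] (@rVcons n).
Proof.
apply: measurable_fun_rV => i; have [j ->|->] := unliftP ord0 i.
  under eq_fun do rewrite rVconsS.
  exact: (measurableT_comp (measurable_rV_coord j) measurable_snd).
by under eq_fun do rewrite rVcons0; exact: measurable_fst.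
Qed.

Let measurable_rVuncons n : measurable_fun [set: _] (@rVuncons n).
Proof.
apply: measurable_fun_pair; first exact: measurable_rV_coord.
apply: measurable_fun_rV => i; under eq_fun do rewrite mxE.
exact: measurable_rV_coord.
Qed.

Section step.
Variables (n : nat) (mu : {sigma_finite_measure set 'rV[R]_n -> \bar R}).

Definition lebesgue_rV_step : set 'rV[R]_n.+1 -> \bar R :=
  pushforward (lebesgue_measure \x mu)%E (@rVcons n).


Let step0 : lebesgue_rV_step set0 = 0%E.
Proof. by rewrite /lebesgue_rV_step/pushforward preimage_set0 measure0. Qed.

Let step_ge0 A : (0 <= lebesgue_rV_step A)%E.
Proof. exact: (@measure_ge0 _ _ _ (lebesgue_measure \x mu)%E). Qed.

Let step_additive : semi_sigma_additive lebesgue_rV_step.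
Proof.
exact: (@measure_semi_sigma_additive _ _ _
  (measure_function_pushforward__canonical__measure_function_Measure
    (lebesgue_measure \x mu)%E (@measurable_rVcons n))).
Qed.

HB.instance Definition _ := isMeasure.Build _ _ _ lebesgue_rV_step
  step0 step_ge0 step_additive.

Let step_sigma_finite : sigma_finite setT lebesgue_rV_step.
Proof.
have /sigma_finiteP[F [FT ndF Foo]] :=
  sigma_finiteT (@lebesgue_measure R : {sigma_finite_measure set _ -> \bar R}).
have /sigma_finiteP[G [GT ndG Goo]] := sigma_finiteT mu.
exists (fun k => @rVuncons n @^-1` (F k `*` G k)).
  rewrite -preimage_bigcup -(preimage_setT (@rVuncons n)); congr (_ @^-1` _).
  rewrite -setXTT FT GT; apply/seteqP; split => [[x y]|[x y] [k _ []]] /=.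
    move=> [[i _ Fx] [j _ Gy]]; exists (maxn i j) => //; split.
    - by move: x Fx; exact/subsetPset/ndF/leq_maxl.
    - by move: y Gy; exact/subsetPset/ndG/leq_maxr.
  by move=> Fx Gy; split; exists k.
move=> k; have [mF Fk] := Foo k; have [mG Gk] := Goo k; split.
  rewrite -[X in measurable X]setTI; apply: measurable_rVuncons => //.
  exact: measurableX.
rewrite /lebesgue_rV_step /pushforward.
rewrite (_ : _ @^-1` _ = F k `*` G k); last first.
  by apply/funext => p; rewrite /preimage /mkset rVconsK.
by rewrite product_measure1E// lte_mul_pinfty// ge0_fin_numE.
Qed.

HB.instance Definition _ := Measure_isSigmaFinite.Build _ _ _
  lebesgue_rV_step step_sigma_finite.

End step.

(* R^0 is a point, of mass 1; R^(n+1) = R x R^n carries the product measure. *)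
Fixpoint lebesgue_rV n : {sigma_finite_measure set 'rV[R]_n -> \bar R} :=
  match n with
  | 0 => dirac (0 : 'rV[R]_0)
  | n'.+1 => lebesgue_rV_step (lebesgue_rV n')
  end.

(* By sigma-finiteness this determines the measure on Borel sets. *)
Lemma lebesgue_rV_prod n (A : 'I_n -> set R) : (forall i, measurable (A i)) ->
  lebesgue_rV n [set v : 'rV[R]_n | forall i, A i (v ord0 i)] =
  (\prod_(i < n) lebesgue_measure (A i))%E.
Proof.
elim: n A => [|n IH] A mA.
  by rewrite big_ord0 /= diracE mem_set// => -[].
rewrite big_ord_recl -IH => [|i]; last exact: mA.
rewrite -product_measure1E => [||]; [|exact: mA|].
  rewrite /= /lebesgue_rV_step /pushforward; congr (_ _).
  apply/seteqP; split => -[x v]/=.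
    move=> Ap; split; first by have := Ap ord0; rewrite rVcons0.
    by move=> i; have := Ap (lift ord0 i); rewrite rVconsS.
  move=> [Ax Av] i; have [j ->|->] := unliftP ord0 i.
    by rewrite rVconsS; exact: Av.
  by rewrite rVcons0.
rewrite (_ : [set _ | _] = \bigcap_(i in [set: 'I_n])
    ((fun t : 'rV[R]_n => t ord0 i) @^-1` A (lift ord0 i))); last first.
  by apply/seteqP; split=> t /= h i => [_|]; apply: h.
apply: fin_bigcap_measurable; [exact: finite_finset|move=> i _].
rewrite -[X in measurable X]setTI.
by apply: measurable_rV_coord => //; exact: mA.
Qed.

End lebesgue_rV.

Section euclidean.
Context {R : realType} {n : nat}.
Implicit Types x y : 'rV[R]_n.

Definition enorm x : R := Num.sqrt (\sum_(i < n) x ord0 i ^+ 2).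

Definition eball y (r : R) : set 'rV[R]_n := [set x | enorm (x - y) < r].

End euclidean.

Section bounded_variation.
Context {R : realType} {n : nat}.
Implicit Types (phi : 'rV[R]_n -> 'rV[R]_n) (u : 'rV[R]_n -> R).

Definition divergence phi (x : 'rV[R]_n) : R :=
  \sum_(i < n) 'D_(delta_mx ord0 i) (fun y => phi y ord0 i) x.

Definition C1c phi : Prop :=
  [/\ forall x, differentiable phi x,
      continuous (fun x => 'J phi x) &
      compact (closure [set x | phi x != 0])].

(* \int |Du|, where |phi|_oo is the sup over x of the Euclidean norm of phi x *)
Definition total_variation u : \bar R :=
  ereal_sup [set (\int[lebesgue_rV n]_x (u x * divergence phi x)%:E)%E |
              phi in [set phi | C1c phi /\ forall x, enorm (phi x) <= 1]].

(* L^1 and BV are sets of (Borel) functions, not quotiented by a.e. equality;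
   everything below only depends on the class of u. *)
Definition BV : set ('rV[R]_n -> R) :=
  [set u | u \in Lfun (lebesgue_rV n) 1 /\ (total_variation u < +oo)%E].

Definition BV_norm u : \bar R :=
  (total_variation u + \int[lebesgue_rV n]_x `|u x|%:E)%E.

End bounded_variation.

Definition Sobolev_exponent (R : realType) (n : nat) : R := n%:R / (n%:R - 1).

(* convergence to 0 in the space L^s: membership is part of the claim *)
Definition Lp_cvg0 (R : realType) (n : nat) (s : R) (u : nat -> 'rV[R]_n -> R) :=
  (forall k, u k \in Lfun (lebesgue_rV n) s%:E) /\
  'N[lebesgue_rV n]_(s%:E)[EFin \o u k]%E @[k --> \oo] --> 0%E.

(* Main.v *)
Require Import Defs.
From mathcomp Require Import all_boot all_order all_algebra.
From mathcomp Require Import ring lra.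
From mathcomp Require Import all_classical all_reals all_analysis.
From mathcomp Require Import measurable_realfun.

Set Implicit Arguments.
Unset Strict Implicit.
Unset Printing Implicit Defensive.

Import Order.TTheory GRing.Theory Num.Theory.
Import numFieldNormedType.Exports.

Local Open Scope classical_set_scope.
Local Open Scope ring_scope.

(** A function of bounded variation satisfies, for every translation, the bound
    $\int |u(x) - u(x+z)| dx \le (\sum_i |z_i|) \int |Du|$, and the whole proof
    rests on this property.

    The bound is obtained by duality.  If $g$ is a test function then
    $g(x) - g(x - t e_i)$ is the divergence of the field $\Phi e_i$, where
    $\Phi(x) = P(x) - P(x - t e_i)$ and $\partial_i P = g$.  By the mean value
    theorem $\Phi(x) = t g(\xi)$ for some $\xi$ on the segment, which bounds
    $\Phi$ by $t$ and its support at one stroke ([integral_test_difference_le]).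
    The functions $g$ are finite sums of products of one-variable functions, so
    that $P$ is explicit; they are an algebra containing bumps on boxes, hence
    approximate the sign of an integrable function
    ([integral_norm_le_of_test]).

    Now let $|u| > \lambda$ at $x$ while the mean of $|u|$ over the cube
    $x + [0,d]^N$ is at most $\lambda/2$.  Then the mean of $|u(x) - u(x+z)|$
    over $z$ in the cube is at least $|u(x)|/2$, and integrating in $x$ gives
    $\int_{|u|>\lambda} |u| \le 2 N d \int |Du|$ ([tail_integral_le_variation]).
    When $\int_{B_r(y)} |u|^p$ is bounded uniformly in $y$, the hypothesis on the
    mean holds with $d$ proportional to $\lambda^{-p/N}$.  Summing over dyadic
    levels bounds $\int |u|^s$ for every $s < 1 + p/N$, with a constant that
    tends to zero with the local bound ([global_power_integral_le]).

    So vanishing of the local $p$-th powers implies vanishing of the $s$-th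
    powers for all $1 < s < 1 + p/N$, and this can be iterated: the critical
    exponent is the fixed point of $p \mapsto 1 + p/N$, and every step divides
    the distance to it by almost $N$ ([exponent_bootstrap]).  The same iteration
    started from $p = 1$, with finiteness instead of smallness,
    shows that each $u_n$ belongs to $L^s$. *)

(* total_variation also names the variation of a function on an interval. *)
Local Notation total_variation := Defs.total_variation.

(** * Translation invariance of Lebesgue measure *)

Section rectangles.
Context {R : realType} {n : nat}.

Definition rectangle (B : 'I_n -> set R) : set 'rV[R]_n :=
  [set v | forall i, B i (v ord0 i)].

Lemma measurable_rectangle (B : 'I_n -> set R) :
  (forall i, measurable (B i)) -> measurable (rectangle B).
Proof.
move=> mB; rewrite (_ : rectangle B = \bigcap_(i in [set: 'I_n])
    ((fun t : 'rV[R]_n => t ord0 i) @^-1` B i)); last first.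
  by apply/seteqP; split=> t /= h i => [_|]; apply: h.
apply: fin_bigcap_measurable; [exact: finite_finset|move=> i _].
rewrite -[X in measurable X]setTI.
by apply: measurable_rV_coord => //; exact: mB.
Qed.

(** To show that a family of sets generates the Borel sets it is enough to
    produce slabs: the identity is then measurable coordinate by coordinate,
    from the generated structure to the Borel one. *)
Lemma borel_sub_generated (G : set (set 'rV[R]_n)) :
  (forall i (B : set R), (exists a b, B = `]a, b[%classic) ->
    (<<s G >>) [set v : 'rV[R]_n | B (v ord0 i)]) ->
  (@measurable _ 'rV[R]_n) `<=` <<s G >>.
Proof.
move=> GB A mA.
have : measurable_fun [set: g_sigma_algebraType G]
    (fun v : g_sigma_algebraType G => (v : 'rV[R]_n)).
  apply: measurable_fun_rV => i.
  apply: (measurability _ (RGenOpens.measurableE R)).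
  move=> _ [_ [a [b ->]] <-]; rewrite setTI.
  by apply: GB; exists a, b.
by move=> /(_ measurableT _ mA); rewrite setTI.
Qed.

End rectangles.

Section translation.
Context {R : realType}.

Lemma lebesgue_measure_shift (h : R) (A : set R) : measurable A ->
  lebesgue_measure ((fun x => x + h) @^-1` A) = lebesgue_measure A.
Proof.
move=> mA.
have mf : measurable_fun [set: measurableTypeR R]
    (fun x : measurableTypeR R => (x + h : measurableTypeR R)).
  exact: measurable_funD.
rewrite [RHS](lebesgue_measure_unique (mu :=
  measure_function_pushforward__canonical__measure_function_Measure
    (@lebesgue_measure R) mf)) //.
move=> _ [[a b] _ <-] /=; rewrite /pushforward.
rewrite (_ : _ @^-1` _ = `]a - h, b - h]%classic); last first.
  by apply/seteqP; split => x /=; rewrite !in_itv/= ltrBlDr lerBrDr.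
rewrite !lebesgue_measure_itv/= !lte_fin ltrD2r.
by case: ifPn => // _; rewrite -!EFinD; congr EFin; ring.
Qed.

Context {n : nat}.
Local Notation mu := (@lebesgue_rV R n).

Lemma measurable_shift (h : 'rV[R]_n) :
  measurable_fun [set: 'rV[R]_n] (fun x => x + h).
Proof.
apply: measurable_fun_rV => i; under eq_fun do rewrite mxE.
by apply: measurable_funD => //; exact: measurable_rV_coord.
Qed.

(** Both measures agree on rectangles with measurable sides, where the claim is
    one-dimensional; rectangles are stable under intersection and generate. *)
Lemma lebesgue_rV_shift (h : 'rV[R]_n) (A : set 'rV[R]_n) : measurable A ->
  mu ((fun x => x + h) @^-1` A) = mu A.
Proof.
move=> mA; apply/esym.
pose G := [set A : set 'rV[R]_n |
  exists2 B, (forall i, measurable (B i)) & A = rectangle B].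
pose g k : set 'rV[R]_n := rectangle (fun=> `]- k%:R, k%:R[%classic : set R).
rewrite (@measure_unique _ _ _ G g _ _ _ _ mu
  (measure_function_pushforward__canonical__measure_function_Measure
    mu (measurable_shift h)))//.
- apply/seteqP; split.
    apply: borel_sub_generated => i B [a [b ->]]; apply: sub_sigma_algebra.
    exists (fun j => if j == i then `]a, b[%classic else setT).
      by move=> j; case: ifP => _ //; exact: measurable_itv.
    apply/seteqP; split => [v /= vi j|v /= /(_ i)]; last by rewrite eqxx.
    by case: eqP => // ->.
  apply: smallest_sub; first exact: sigma_algebra_measurable.
  by move=> _ [B mB ->]; exact: measurable_rectangle.
- move=> _ _ [B mB ->] [C mC ->]; exists (fun i => B i `&` C i).
    by move=> i; exact: measurableI.
  apply/seteqP; split => v /=; first by move=> [vB vC] i; split; [exact: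
    vB|exact: vC].
  by move=> vBC; split => i; have [] := vBC i.
- by move=> k; exists (fun=> `]- k%:R, k%:R[%classic).
- apply/seteqP; split => // v _; exists (Num.truncn (\sum_i `|v ord0 i|)).+1 =>
    // i.
  rewrite /= in_itv/= -ltr_norml.
  apply: le_lt_trans (truncnS_gt _).
  by rewrite (bigD1 i)//= lerDl sumr_ge0.
- move=> _ [B mB ->]; rewrite /= /pushforward.
  rewrite (_ : _ @^-1` _ = rectangle (fun i => (fun x => x +
    h ord0 i) @^-1` B i)); last first.
    by apply/seteqP; split => v /= + i => /(_ i); rewrite mxE.
  rewrite /rectangle lebesgue_rV_prod//; apply/esym.
  apply: etrans (lebesgue_rV_prod
      (A := fun i => (fun x => x + h ord0 i) @^-1` B i) _) _; last first.
    by apply: eq_bigr => i _; rewrite lebesgue_measure_shift.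
  move=> i; rewrite -[X in measurable X]setTI.
  have : measurable_fun [set: R] (fun x : R => x + h ord0 i).
    exact: measurable_funD.
  exact.
- move=> k; apply: (@le_lt_trans _ _
      (\prod_(i < n) lebesgue_measure (`](- k%:R)%R, (k%:R)%R[%classic :
        set R))%E).
    by rewrite le_eqVlt; apply/orP; left; apply/eqP; exact: lebesgue_rV_prod.
  rewrite ltey_eq prode_fin_num// => i _.
  by rewrite lebesgue_measure_itv/=; case: ifP.
Qed.

Lemma ge0_integral_shift (h : 'rV[R]_n) (f : 'rV[R]_n -> \bar R) :
  measurable_fun setT f -> (forall x, 0 <= f x)%E ->
  (\int[mu]_x f (x + h)%R = \int[mu]_x f x)%E.
Proof.
move=> mf f0; have mh := measurable_shift h.
rewrite -(ge0_integral_pushforward mh mu measurableT mf) ?preimage_setT//.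
apply: eq_measure_integral => A mA _; exact: lebesgue_rV_shift.
Qed.

End translation.

(** * Continuously differentiable functions and fields along an axis *)

Section C1_functions.
Context {R : realType} {n : nat}.
Implicit Types f g : 'rV[R]_n -> R.

Definition C1 f : Prop :=
  (forall x, differentiable f x) /\ forall v, continuous (fun x => 'D_v f x).

Lemma C1_derivable f x v : C1 f -> derivable f x v.
Proof. by move=> [df _]; exact: diff_derivable. Qed.

Lemma C1_continuous f : C1 f -> continuous f.
Proof. by move=> [df _] x; exact: differentiable_continuous. Qed.

Lemma C1_of_derive f (Df : 'rV[R]_n -> 'rV[R]_n -> R) :
  (forall x, differentiable f x) -> (forall v x, 'D_v f x = Df v x) ->
  (forall v, continuous (Df v)) -> C1 f.
Proof.
move=> df DfE cDf; split=> // v.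
have -> : 'D_v f = Df v by apply/funext => x; exact: DfE.
exact: cDf.
Qed.

Lemma C1_cst (c : R) : C1 (fun=> c).
Proof.
apply: (@C1_of_derive _ (fun _ _ => 0)) => [x|v x|v].
- exact: differentiable_cst.
- exact: derive_cst.
- exact: cst_continuous.
Qed.

Lemma C1D f g : C1 f -> C1 g -> C1 (fun x => f x + g x).
Proof.
move=> Cf Cg; have [df cf] := Cf; have [dg cg] := Cg.
apply: (@C1_of_derive _ (fun v x => 'D_v f x + 'D_v g x)) => [x|v x|v x].
- exact: differentiableD.
- by apply: deriveD; exact: C1_derivable.
- exact: (continuousD (cf v x) (cg v x)).
Qed.

Lemma C1M f g : C1 f -> C1 g -> C1 (fun x => f x * g x).
Proof.
move=> Cf Cg; have [df cf] := Cf; have [dg cg] := Cg.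
apply: (@C1_of_derive _ (fun v x => f x * 'D_v g x + g x * 'D_v f x)) =>
  [x|v x|v x].
- exact: differentiableM.
- by apply: deriveM; exact: C1_derivable.
- apply: (@continuousD _ _ _ (fun x => f x * 'D_v g x) (fun x => g x * 'D_v f x)).
    exact: (continuousM (C1_continuous Cf (x := x)) (cg v x)).
  exact: (continuousM (C1_continuous Cg (x := x)) (cf v x)).
Qed.

Lemma C1_prod (I : Type) (s : seq I) (F : I -> 'rV[R]_n -> R) :
  (forall i, C1 (F i)) -> C1 (fun x => \prod_(i <- s) F i x).
Proof.
move=> CF; elim: s => [|i s IH].
  by under eq_fun do rewrite big_nil; exact: C1_cst.
by under eq_fun do rewrite big_cons; exact: C1M.
Qed.

Lemma C1_coord (h h' : R -> R) (j : 'I_n) :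
  (forall x : R, is_derive x 1 h (h' x)) -> continuous h' ->
  C1 (fun x => h (x ord0 j)).
Proof.
move=> dh ch'.
have dj (x : 'rV[R]_n) : differentiable (fun v : 'rV[R]_n => v ord0 j : R) x.
  exact: differentiable_coord.
have dhx (y : R) : differentiable h y by exact/derivable1_diffP.
have dc (x : 'rV[R]_n) : differentiable (fun x : 'rV[R]_n => h (x ord0 j)) x.
  exact: (@differentiable_comp _ _ _ _ (fun v : 'rV[R]_n => v ord0 j) h).
apply: (@C1_of_derive _ (fun v x => v ord0 j * h' (x ord0 j))) => [//|v x|v x].
  rewrite deriveE// (@diff_comp _ _ _ _ (fun v : 'rV[R]_n => v ord0 j) h)//=.
  rewrite -[in X in _ X = _]deriveE// (_ : 'D_v _ x = v ord0 j); last first.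
    apply: cvg_lim => //.
    apply: (@cvg_trans _ (cst (v ord0 j) @ (0:R)^')); last exact: cvg_cst.
    apply: near_eq_cvg; near=> t; rewrite /= !mxE addrK.
    by rewrite /GRing.scale/= mulKf//; near: t; exact: nbhs_dnbhs_neq.
  have -> : v ord0 j = v ord0 j *: (1 : R) by rewrite /GRing.scale/= mulr1.
  rewrite linearZ/= -deriveE//.
  have /= -> := @derive_val _ _ _ _ _ _ _ (dh (x ord0 j)).
  by rewrite /GRing.scale/= mulr1.
apply: (@continuousM _ _ (fun=> v ord0 j) (fun x : 'rV[R]_n => h' (x ord0 j))).
  exact: cst_continuous.
apply: (@continuous_comp _ _ _ (fun v : 'rV[R]_n => v ord0 j) h').
  exact: coord_continuous.
exact: ch'.
Unshelve. all: by end_near. Qed.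

Lemma derive_shift_rV f (h v x : 'rV[R]_n) :
  'D_v (fun y => f (y + h)) x = 'D_v f (x + h).
Proof. by rewrite /derive; under eq_fun do rewrite /= -addrA. Qed.

Lemma C1_shift f (h : 'rV[R]_n) : C1 f -> C1 (fun x => f (x + h)).
Proof.
move=> [df cf].
have dh (x : 'rV[R]_n) : differentiable (fun x : 'rV[R]_n => x + h) x.
  by apply: differentiableD => //; exact: differentiable_cst.
apply: (@C1_of_derive _ (fun v x => 'D_v f (x + h))) => [x|v x|v x].
- exact: (@differentiable_comp _ _ _ _ (fun x : 'rV[R]_n => x + h) f).
- exact: derive_shift_rV.
- apply: (@continuous_comp _ _ _ (fun x : 'rV[R]_n => x + h) ('D_v f)).
    exact: differentiable_continuous.
  exact: cf.
Qed.

Lemma is_derive_line f (x v : 'rV[R]_n) (t : R) : C1 f ->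
  is_derive t 1 (fun s : R => f (x + s *: v)) ('D_v f (x + t *: v)).
Proof.
move=> Cf; have dv := C1_derivable Cf (x := x + t *: v) (v := v).
have E : (fun h : R => h^-1 *: (f (h *: v + (x + t *: v)) - f (x + t *: v))) =
    (fun h : R => h^-1 *: (f (x + (h *: (1 : R) + t) *: v) - f (x + t *: v))).
  apply/funext => h; congr (_ *: (f _ - _)).
  by rewrite scalerDl /GRing.scale/= mulr1 addrCA.
apply: DeriveDef; first by move: dv; rewrite /derivable E.
by rewrite /derive -E.
Qed.

Lemma C1_mvt f (x v : 'rV[R]_n) (t : R) : C1 f -> 0 <= t ->
  exists2 c, 0 <= c <= t & f x - f (x - t *: v) = t * 'D_v f (x - c *: v).
Proof.
move=> Cf t0.
have [| |c] := @MVT_segment R (fun s => f ((x - t *: v) + s *: v))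
    (fun s => 'D_v f ((x - t *: v) + s *: v)) 0 t t0.
- by move=> s _; exact: is_derive_line.
- apply: continuous_subspaceT => s.
  apply: differentiable_continuous; apply/derivable1_diffP.
  by have [] := is_derive_line (x - t *: v) v s Cf.
rewrite scale0r addr0 subrK subr0 in_itv/= => /andP[c0 ct] ->.
exists (t - c); first by lra.
by rewrite mulrC scalerBl opprB addrA addrAC.
Qed.

(** Fields with a single nonzero component suffice below.  Compact support is
    phrased coordinatewise because test functions are products over the
    coordinates. *)
Lemma C1c_field (F : 'rV[R]_n -> R) (i : 'I_n) (K : R) : C1 F ->
  (forall (x : 'rV[R]_n) j, K < `|x ord0 j| -> F x = 0) ->
  C1c (fun x => F x *: (delta_mx ord0 i : 'rV[R]_n)).
Proof.
move=> CF F0; have [dF cF] := CF.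
have dphi x : differentiable (fun x => F x *: (delta_mx ord0 i : 'rV[R]_n)) x.
  exact: differentiableZl.
split => //.
  have -> : (fun x => 'J (fun x => F x *: delta_mx ord0 i) x) =
     (fun x => \sum_(a < n) 'D_(delta_mx ord0 a) F x *: (delta_mx a i : 'M[R]_n)).
    apply/funext => x; apply/row_matrixP => a.
    rewrite rowE -deriveEjacobian//.
    have -> : 'D_(delta_mx ord0 a) (fun x => F x *: delta_mx ord0 i) x =
        'D_(delta_mx ord0 a) F x *: (delta_mx ord0 i : 'rV[R]_n).
      apply/cvg_lim => //.
      have := C1_derivable CF (x := x) (v := delta_mx ord0 a).
      move=> /(cvgZr_tmp (a := (delta_mx ord0 i : 'rV[R]_n))).
      apply: cvg_trans; apply: near_eq_cvg; near=> t.
      by rewrite /= -scalerBl scalerA.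
    rewrite linear_sum/= (bigD1 a)//= big1 ?addr0 => [|b ba].
      by apply/rowP => b; rewrite !mxE !eqxx.
    by apply/rowP => c; rewrite !mxE eq_sym (negbTE ba) mulr0.
  apply: continuous_big => [|a _ x]; first exact: add_continuous.
  exact: (continuousZr_tmp (a := delta_mx a i :
    'M[R]_n) (cF (delta_mx ord0 a) x)).
apply: bounded_closed_compact; last exact: closed_closure.
exists (Num.max 0 K); split; first exact: num_real.
move=> M KM; have M0 : 0 <= M by apply: ltW; apply: le_lt_trans KM;
  rewrite le_max lexx.
have /closure_id -> // : closed [set x : 'rV[R]_n | `|x| <= M].
  rewrite (_ : [set x | _] = (@Num.Def.normr R 'rV[R]_n) @^-1` [set x :
    R | x <= M])//.
  by apply: closed_comp; [move=> x _; exact: norm_continuous|exact: closed_le].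
apply: closureS => x /=.
have [->|] := eqVneq (F x) 0; first by rewrite scale0r eqxx.
move=> Fx _; rewrite /Num.Def.normr/= mx_normrE (bigmax_le _ M0)//= => -[j k] _.
rewrite (ord1 j) leNgt; apply/negP => /= Mx.
move/eqP: Fx; apply; apply: (F0 _ k).
by apply: le_lt_trans Mx; apply: ltW; apply: le_lt_trans KM;
  rewrite le_max lexx orbT.
Unshelve. all: by end_near.
Qed.

Lemma divergence_field (F : 'rV[R]_n -> R) (i : 'I_n) x :
  divergence (fun x => F x *: (delta_mx ord0 i : 'rV[R]_n)) x =
  'D_(delta_mx ord0 i) F x.
Proof.
rewrite /divergence (bigD1 i)//= big1 ?addr0.
  by congr ('D__ _ _); apply/funext => y; rewrite !mxE !eqxx mulr1.
move=> j ji; rewrite (_ : (fun y => _) = cst 0) ?derive_cst//.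
by apply/funext => y; rewrite !mxE (negbTE ji) andbF mulr0.
Qed.

Lemma enorm_field (c : R) (i : 'I_n) : enorm (c *: (delta_mx ord0 i :
  'rV[R]_n)) = `|c|.
Proof.
rewrite /enorm (bigD1 i)//= big1 ?addr0 ?mxE ?eqxx ?mulr1 ?sqrtr_sqr//.
by move=> j ji; rewrite !mxE (negbTE ji) andbF mulr0 expr0n.
Qed.

End C1_functions.

(** * Functions of one variable: primitives and bumps *)

Section C1_line.
Context {R : realType}.
Implicit Types f g : R -> R.

Definition C1_line f : Prop :=
  exists2 f' : R -> R, forall x : R, is_derive x 1 f (f' x) & continuous f'.

Lemma C1_line_continuous f : C1_line f -> continuous f.
Proof.
move=> [f' df _] x; apply: differentiable_continuous.
by apply/derivable1_diffP; have [] := df x.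
Qed.

Lemma C1_line_cst (c : R) : C1_line (fun=> c).
Proof. by exists (fun=> 0); [move=> x; exact: is_derive_cst|exact:
  cst_continuous]. Qed.

Lemma C1_line_id : C1_line (fun x => x).
Proof. by exists (fun=> 1); [move=> x; exact: is_derive_id|exact:
  cst_continuous]. Qed.

Lemma C1_lineD f g : C1_line f -> C1_line g -> C1_line (fun x => f x + g x).
Proof.
move=> [f' df cf] [g' dg cg]; exists (fun x => f' x + g' x).
  by move=> x; exact: is_deriveD.
by move=> x; exact: (continuousD (cf x) (cg x)).
Qed.

Lemma C1_lineM f g : C1_line f -> C1_line g -> C1_line (fun x => f x * g x).
Proof.
move=> Cf Cg; have [f' df cf] := Cf; have [g' dg cg] := Cg.
exists (fun x => f x * g' x + g x * f' x).
  by move=> x; exact: is_deriveM.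
move=> x; apply: (@continuousD _ _ _ (fun x => f x * g' x) (fun x => g x * f' x)).
  exact: (continuousM (C1_line_continuous Cf (x := x)) (cg x)).
exact: (continuousM (C1_line_continuous Cg (x := x)) (cf x)).
Qed.

Lemma C1_line_comp f g : C1_line f -> C1_line g -> C1_line (fun x => f (g x)).
Proof.
move=> Cf Cg; have [f' df cf] := Cf; have [g' dg cg] := Cg.
exists (fun x => f' (g x) * g' x).
  by move=> x; exact: is_derive1_comp.
move=> x; apply: (@continuousM _ _ (fun x => f' (g x)) g'); last exact: cg.
exact: (@continuous_comp _ _ _ g f' x (C1_line_continuous Cg (x := x)) (cf _)).
Qed.

(** The square of the positive part.  With the absolute value in place of a
    maximum, a single formula covers both signs. *)
Definition sqpos (y : R) : R := ((y + `|y|) / 2) ^+ 2.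

Lemma sqpos_ge0 y : 0 <= sqpos y.
Proof. exact: sqr_ge0. Qed.

Lemma sqpos_npos y : y <= 0 -> sqpos y = 0.
Proof. by move=> y0; rewrite /sqpos ler0_norm// subrr mul0r expr0n. Qed.

Lemma sqpos_nneg y : 0 <= y -> sqpos y = y ^+ 2.
Proof. by move=> y0; rewrite /sqpos ger0_norm//; congr (_ ^+ 2); lra. Qed.

(** The second-order remainder of [sqpos] is at most the square of the
    increment on either side of the corner, which settles the derivative at
    all points uniformly. *)
Lemma sqpos_C1 : C1_line sqpos.
Proof.
exists (fun y => y + `|y|); last first.
  move=> x; apply: (@continuousD _ _ _ (fun x : R => x) Num.norm) => //.
  exact: norm_continuous.
move=> x.
have H h : `|sqpos (h + x) - sqpos x - h * (x + `|x|)| <= h ^+ 2.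
  rewrite ler_norml; have [x0|x0] := lerP 0 x; have [hx0|hx0] := lerP 0 (h + x);
    rewrite ?(sqpos_nneg hx0) ?(sqpos_npos (ltW hx0)) ?(sqpos_nneg x0)
      ?(sqpos_npos (ltW x0)) ?(ger0_norm x0) ?(ltr0_norm x0) !expr2;
        apply/andP; split; nra.
have L : (fun h => h^-1 *: (sqpos (h *: (1 : R) + x) - sqpos x)) @ (0 :
  R)^' --> x + `|x|.
  apply/cvgrPdist_le => e e0; near=> h.
  have h0 : h != 0 by near: h; exact: nbhs_dnbhs_neq.
  have -> : x + `|x| - h^-1 *: (sqpos (h *: (1 : R) + x) - sqpos x) =
      - (h^-1 * (sqpos (h + x) - sqpos x - h * (x + `|x|))).
    rewrite /GRing.scale/= mulr1; field. exact: h0.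
  rewrite normrN normrM normfV ler_pdivrMl ?normr_gt0//.
  apply: le_trans (H h) _; rewrite -real_normK ?num_real// expr2 ler_wpM2l//.
  near: h; exact: dnbhs0_le.
apply: DeriveDef; last exact/cvg_lim.
by apply/cvg_ex; eexists; exact: L.
Unshelve. all: by end_near. Qed.

Definition C1c_line f : Prop :=
  C1_line f /\ exists K : R, forall x, K < `|x| -> f x = 0.

Lemma C1c_lineM f g : C1c_line f -> C1c_line g -> C1c_line (fun x => f x * g x).
Proof.
move=> [Cf [K fK]] [Cg _]; split; first exact: C1_lineM.
by exists K => x /fK ->; rewrite mul0r.
Qed.

Lemma C1c_line_primitive f : C1c_line f ->
  exists F, forall x : R, is_derive x 1 F (f x).
Proof.
move=> [Cf [K fK]].
have cf := C1_line_continuous Cf.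
have intf : (@lebesgue_measure R).-integrable setT (EFin \o f).
  have := @continuous_compact_integrable R f `[- K, K]%classic
    (@segment_compact _ _ _) (continuous_subspaceT cf).
  rewrite integrable_mkcond//.
  apply: eq_integrable => // x _.
  rewrite patchE/= mem_setE in_itv/= -ler_norml; case: ifPn => //=.
  by rewrite -ltNge => /fK ->.
exists (fun x => \int[@lebesgue_measure R]_(t in `]-oo, x]) f t) => x.
have xx1 : x < x + 1 by rewrite ltrDl.
have intx : (@lebesgue_measure R).-integrable `]-oo, x + 1] (EFin \o f).
  exact: integrableS intf.
have [dF F'] := @continuous_FTC1 R f -oo%O x (x + 1) xx1 intx (ltNyr x) (cf x).
by apply: DeriveDef => //; rewrite -derive1E.
Qed.

(** Approximates the indicator of an open interval.  The inner square vanishes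
    outside the interval, where the value is exactly 0; inside, the outer square
    vanishes as soon as k is large, and the value is then exactly 1. *)
Definition bump (a b : R) (k : nat) (x : R) : R :=
  1 - sqpos (1 - k%:R * sqpos ((x - a) * (b - x))).

Lemma bump_ge0 a b k x : 0 <= bump a b k x.
Proof.
rewrite /bump subr_ge0; set y := _ * _.
have y0 : 0 <= y by rewrite mulr_ge0 ?sqpos_ge0.
have [?|?] := lerP 0 (1 - y); first by rewrite sqpos_nneg//; nra.
by rewrite sqpos_npos//; lra.
Qed.

Lemma bump_le1 a b k x : bump a b k x <= 1.
Proof. by rewrite /bump gerBl sqpos_ge0. Qed.

Lemma bump_C1c a b k : a < b -> C1c_line (bump a b k).
Proof.
move=> ab; split.
  have C1B (f : R -> R) c : C1_line f -> C1_line (fun x => c - f x).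
    move=> Cf; rewrite (_ : (fun x => c - f x) = fun x => c + (-1) * f x).
      apply: C1_lineD; first exact: C1_line_cst.
      by apply: C1_lineM => //; exact: C1_line_cst.
    by apply/funext => x; rewrite mulN1r.
  apply: (C1B); apply: (C1_line_comp sqpos_C1); apply: (C1B).
  apply: C1_lineM; first exact: C1_line_cst.
  apply: (C1_line_comp sqpos_C1); apply: C1_lineM.
    by apply: C1_lineD; [exact: C1_line_id|exact: C1_line_cst].
  by apply: (C1B); exact: C1_line_id.
exists (`|a| + `|b|) => x abx; rewrite /bump.
rewrite (sqpos_npos (y := (x - a) * (b - x))); last first.
  have := ler_norm a; have := ler_norm b.
  have := ler_norm (- a); have := ler_norm (- b); rewrite !normrN.
  by have [x0|x0] := lerP 0 x; move: abx;
    rewrite ?(ger0_norm x0) ?(ltr0_norm x0); nra.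
by rewrite mulr0 subr0 sqpos_nneg// expr1n subrr.
Qed.

Lemma bump_cvg a b x : a < b ->
  bump a b k x @[k --> \oo] --> (\1_(`]a, b[%classic) x : R).
Proof.
move=> ab; rewrite indicE mem_setE in_itv/=.
have [/andP[ax xb]|] := boolP (_ && _).
  have p0 : 0 < (x - a) * (b - x) by rewrite mulr_gt0// subr_gt0.
  apply: cvg_near_cst; near=> k; rewrite /bump (sqpos_npos (y := 1 - _)) ?subr0//.
  rewrite subr_le0 (sqpos_nneg (ltW p0)) -ler_pdivrMr ?exprn_gt0//.
  near: k; exact: nbhs_infty_ger.
move=> nx; apply: cvg_near_cst; near=> k;
  rewrite /bump (sqpos_npos (y := (x - a) * (b - x))); last first.
  by move: nx; rewrite negb_and -!leNgt => /orP[] ?; nra.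
by rewrite mulr0 subr0 sqpos_nneg// expr1n subrr.
Unshelve. all: by end_near. Qed.

End C1_line.

(** * Test functions and the variation of a translate *)

Section test_functions.
Context {R : realType} {n : nat}.
Implicit Types g h : 'rV[R]_n -> R.

(** Separated variables make primitives in one coordinate, supports and
    products elementary; continuous differentiability of every factor is needed
    because the field built from a primitive must be of class C1. *)
Inductive test_fun : ('rV[R]_n -> R) -> Prop :=
| test_tensor (c : R) (f : 'I_n -> R -> R) : (forall j, C1c_line (f j)) ->
    test_fun (fun x => c * \prod_(j < n) f j (x ord0 j))
| test_funD g h : test_fun g -> test_fun h -> test_fun (fun x => g x + h x).

Lemma eq_test_fun g h : (forall x, g x = h x) -> test_fun g -> test_fun h.
Proof. by move=> /funext ->. Qed.

Lemma test_funZ (a : R) g : test_fun g -> test_fun (fun x => a * g x).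
Proof.
elim=> [c f Cf|g1 g2 _ IH1 _ IH2].
  by under eq_fun do rewrite mulrA; exact: test_tensor.
by under eq_fun do rewrite mulrDr; exact: test_funD.
Qed.

Lemma test_funB g h : test_fun g -> test_fun h -> test_fun (fun x => g x - h x).
Proof.
move=> Tg Th; apply: (@eq_test_fun (fun x => g x + (-1) * h x)).
  by move=> x; rewrite mulN1r.
by apply: test_funD => //; exact: test_funZ.
Qed.

Lemma test_funM g h : test_fun g -> test_fun h -> test_fun (fun x => g x * h x).
Proof.
elim=> [c f Cf|g1 g2 _ IH1 _ IH2] Th; last first.
  by under eq_fun do rewrite mulrDl; apply: test_funD; [exact: IH1|exact: IH2].
elim: Th => [d k Ck|h1 h2 _ IH1 _ IH2].
  apply: (@eq_test_fun
    (fun x => (c * d) * \prod_(j < n) (f j (x ord0 j) * k j (x ord0 j)))).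
    by move=> x; rewrite mulrACA -big_split.
  by apply: (@test_tensor _ (fun j y => f j y * k j y)) => j; exact: C1c_lineM.
by under eq_fun do rewrite mulrDr; exact: test_funD.
Qed.

Lemma test_fun_measurable g : test_fun g -> measurable_fun setT g.
Proof.
elim=> [c f Cf|g1 g2 _ IH1 _ IH2]; last exact: measurable_funD.
apply: measurable_funM => //; apply: measurable_prod => j _.
apply: measurableT_comp; last exact: measurable_rV_coord.
by apply: continuous_measurable_fun; apply: C1_line_continuous; have [] := Cf j.
Qed.

Lemma test_fun_support g : test_fun g ->
  exists K : R, forall (x : 'rV[R]_n) j, K < `|x ord0 j| -> g x = 0.
Proof.
elim=> [c f Cf|g1 g2 _ [K1 IH1] _ [K2 IH2]]; last first.
  exists (Num.max K1 K2) => x j; rewrite gt_max => /andP[/IH1 -> /IH2 ->].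
  by rewrite addr0.
have K_ j : {K : R | forall x, K < `|x| -> f j x = 0}.
  by apply: cid; have [] := Cf j.
exists (\sum_j `|projT1 (K_ j)|) => x j Kx.
rewrite (bigD1 j)//= (projT2 (K_ j)) ?mul0r ?mulr0//.
apply: le_lt_trans Kx; rewrite (bigD1 j)//=.
apply: le_trans (ler_norm _) _; rewrite lerDl; exact: sumr_ge0.
Qed.

(** Only the i-th factor is integrated.  The primitive itself need not be
    compactly supported; its difference with a translate is. *)
Lemma test_fun_primitive g (i : 'I_n) : test_fun g ->
  exists2 P, C1 P & forall x, 'D_(delta_mx ord0 i) P x = g x.
Proof.
elim=> [c f Cf|g1 g2 _ [P1 C1 D1] _ [P2 C2 D2]]; last first.
  exists (fun x => P1 x + P2 x); first exact: C1D.
  by move=> x; rewrite -D1 -D2; apply: deriveD; exact: C1_derivable.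
have [F dF] := C1c_line_primitive (Cf i).
exists (fun x => (c * F (x ord0 i)) * \prod_(j < n | j != i) f j (x ord0 j)).
  apply: C1M.
    apply: C1M; first exact: C1_cst.
    apply: (C1_coord _ dF).
    by apply: C1_line_continuous; have [] := Cf i.
  under eq_fun do rewrite big_mkcond/=.
  apply: (@C1_prod _ _ _ _ (fun j (x : 'rV[R]_n) =>
    if j != i then f j (x ord0 j) else 1)) => j.
  case: (j != i); last exact: C1_cst.
  by have [[f' df cf'] _] := Cf j; exact: (C1_coord _ df cf').
move=> x; rewrite (bigD1 i)//=.
set K := \prod_(_ < _ | _) f _ _.
have [dKF KFE] := is_deriveZ (c * K) (dF (x ord0 i)).
rewrite (_ : c * _ = (c * K) *: f i (x ord0 i));
  last by rewrite /GRing.scale/=; ring.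
rewrite -[RHS]KFE /derive; set d := (fun _ : R => _); set d' := (fun _ : R => _).
suff -> : d = d' by []; apply/funext => h; rewrite /d /d'; congr (_ *: _).
rewrite /= !mxE !eqxx /=.
rewrite (eq_bigr (fun j => f j (x ord0 j))) => [|j ji].
  by rewrite -/K /GRing.scale/=; ring.
by rewrite !mxE (negbTE ji) andbF mulr0 add0r.
Qed.

End test_functions.

Section total_variation_translation.
Context {R : realType} {n : nat}.
Local Notation mu := (@lebesgue_rV R n).
Implicit Types u g : 'rV[R]_n -> R.

Lemma integral_shift (h : 'rV[R]_n) (f : 'rV[R]_n -> \bar R) :
  measurable_fun setT f ->
  (\int[mu]_x f (x + h)%R = \int[mu]_x f x)%E.
Proof.
move=> mf; rewrite integralE [RHS]integralE.
rewrite (funepos_comp f (fun x => x + h)) (funeneg_comp f (fun x => x + h)).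
congr (_ - _)%E.
  exact: (ge0_integral_shift h (measurable_funepos mf) (funepos_ge0 f)).
exact: (ge0_integral_shift h (measurable_funeneg mf) (funeneg_ge0 f)).
Qed.

Lemma integrable_measurable u : mu.-integrable setT (EFin \o u) ->
  measurable_fun setT u.
Proof. by move=> iu; apply/measurable_EFinP; case/integrableP : iu. Qed.

Lemma integrable_shift (h : 'rV[R]_n) u : mu.-integrable setT (EFin \o u) ->
  mu.-integrable setT (EFin \o (fun x => u (x + h))).
Proof.
move=> /integrableP[mu_ iu]; have mh := measurable_shift h; apply/integrableP;
  split.
  exact: (measurableT_comp mu_ mh).
rewrite (ge0_integral_shift h (f := fun x => `|(u x)%:E|%E))//.
exact: measurableT_comp.
Qed.

Lemma integrable_mul_bounded u g (M : R) : mu.-integrable setT (EFin \o u) ->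
  measurable_fun setT g -> (forall x, `|g x| <= M) ->
  mu.-integrable setT (EFin \o (fun x => u x * g x)).
Proof.
move=> iu mg gM; apply: (integrableMl measurableT iu mg).
by exists M; split; [exact: num_real|move=> K MK x _; exact:
  le_trans (gM x) (ltW MK)].
Qed.

(** The admissible field is $F e_i$ with $F(x) = t^{-1} (P(x) - P(x - t e_i))$
    and $\partial_i P = g$.  The mean value theorem gives $F(x) = g(\xi)$, so
    that $F$ inherits from $g$ both the bound 1 and, up to a margin t, the
    support. *)
Lemma integral_test_difference_le u g (i : 'I_n) (t : R) :
  mu.-integrable setT (EFin \o u) ->
  test_fun g -> (forall x, `|g x| <= 1) -> 0 < t ->
  (\int[mu]_x (u x * (g x - g (x - t *: delta_mx ord0 i)))%:E <=
    t%:E * total_variation u)%E.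
Proof.
move=> iu Tg g1 t0.
set e := delta_mx ord0 i.
have [P CP DP] := test_fun_primitive i Tg.
have [K gK] := test_fun_support Tg.
pose F x := t^-1 * (P x - P (x - t *: e)).
have FE x : exists2 c, 0 <= c <= t & F x = g (x - c *: e).
  have [c ct PE] := C1_mvt x e CP (ltW t0); exists c => //.
  by rewrite /F PE DP mulKf ?gt_eqF.
have CF : C1 F.
  apply: C1M; first exact: C1_cst.
  rewrite (_ : (fun x => _) = fun x => P x + (-1) * P (x - t *: e)); last first.
    by apply/funext => x; rewrite mulN1r.
  by apply: C1D => //; apply: C1M; [exact: C1_cst|exact: (C1_shift (- (t *: e)))].
have F0 (x : 'rV[R]_n) j : K + t < `|x ord0 j| -> F x = 0.
  move=> Kx; have [c /andP[c0 ct] ->] := FE x; apply: (gK _ j).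
  rewrite !mxE eqxx/=; set d : R := (_ == _)%:R.
  have dt : `|c * d| <= t.
    rewrite /d; case: eqP => _; last by rewrite mulr0 normr0 ltW.
    by rewrite mulr1 ger0_norm.
  have := ler_normD (x ord0 j - c * d) (c * d); rewrite subrK; lra.
(* The derivative of F is the difference quotient of g, since D_e P = g. *)
have dF x : 'D_e F x = t^-1 * (g x - g (x - t *: e)).
  have dP : is_derive x e P (g x).
    by apply: DeriveDef; [exact: C1_derivable|exact: DP].
  have dPt : is_derive x e (fun y => P (y + - (t *: e))) (g (x - t *: e)).
    apply: DeriveDef; first by apply: C1_derivable; exact: C1_shift.
    by rewrite derive_shift_rV DP.
  by have [_ ->] := is_deriveZ t^-1 (is_deriveB dP dPt).
have TVF : (\int[mu]_x (u x * (t^-1 * (g x - g (x - t *: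
  e))))%:E <= total_variation u)%E.
  apply: ereal_sup_ubound => /=; exists (fun x => F x *: e).
    split; first exact: C1c_field CF F0.
    by move=> x; rewrite enorm_field; have [c _ ->] := FE x.
  by apply: eq_integral => x _; rewrite divergence_field dF.
rewrite -lee_pdivrMl//.
apply: le_trans TVF; rewrite -integralZl//; last first.
  apply: (integrable_mul_bounded (M := 2)) => //.
    apply: measurable_funB; first exact: test_fun_measurable.
    apply: measurableT_comp; first exact: test_fun_measurable.
    exact: (measurable_shift (- (t *: e))).
  move=> x; apply: le_trans (ler_normB _ _) _.
  by have := g1 x; have := g1 (x - t *: e); lra.
rewrite le_eqVlt; apply/orP; left; apply/eqP; apply: eq_integral => x _.
by rewrite -EFinM; congr EFin; ring.
Qed.

(** Moves the translation from the test function to u. *)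
Lemma integral_increment_test_le u g (i : 'I_n) (t : R) :
  mu.-integrable setT (EFin \o u) ->
  test_fun g -> (forall x, `|g x| <= 1) -> 0 < t ->
  (\int[mu]_x ((u x - u (x + t *: delta_mx ord0 i)) * g x)%:E <=
    t%:E * total_variation u)%E.
Proof.
move=> iu Tg g1 t0; set e := delta_mx ord0 i.
have mg := test_fun_measurable Tg.
have mgt : measurable_fun setT (fun x : 'rV[R]_n => g (x - t *: e)).
  exact: (measurableT_comp mg (measurable_shift (- (t *: e)))).
have iut := integrable_shift (t *: e) iu.
apply: le_trans (integral_test_difference_le i iu Tg g1 t0).
rewrite -/e le_eqVlt; apply/orP; left; apply/eqP.
under eq_integral do rewrite mulrBl EFinB.
under [RHS]eq_integral do rewrite mulrBr EFinB.
rewrite integralB//; [|exact: integrable_mul_bounded g1|exact: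
  integrable_mul_bounded g1].
rewrite [RHS]integralB//; [|exact: integrable_mul_bounded g1|]; last first.
  by apply: (integrable_mul_bounded (M := 1)).
congr (_ - _)%E.
rewrite -[RHS](integral_shift (t *: e)); last first.
  by apply/measurable_EFinP; apply: measurable_funM => //;
    apply/measurable_EFinP; case/integrableP : iu.
by under [RHS]eq_integral do rewrite addrK.
Qed.

End total_variation_translation.

(** * The L1 norm by duality with test functions *)

Section density.
Context {R : realType} {n : nat}.
Local Notation mu := (@lebesgue_rV R n).
Variable w : 'rV[R]_n -> R.
Hypothesis iw : mu.-integrable setT (EFin \o w).
Implicit Types (f g h : 'rV[R]_n -> R) (A : set 'rV[R]_n).

Local Notation wnorm f := (\int[mu]_x (`|w x| * `|f x|)%:E)%E.

#[local] Lemma measurable_wnorm f : measurable_fun setT f ->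
  measurable_fun setT (fun x => (`|w x| * `|f x|)%:E).
Proof.
move=> mf; apply/measurable_EFinP; apply: measurable_funM.
  by apply: measurableT_comp => //; exact: (integrable_measurable iw).
exact: measurableT_comp.
Qed.

#[local] Lemma wnorm_triangle f g h : measurable_fun setT f ->
  measurable_fun setT g ->
  measurable_fun setT h ->
  (forall x, `|h x| <= `|f x| + `|g x|) -> (wnorm h <= wnorm f + wnorm g)%E.
Proof.
move=> mf mg mh fg.
have wint_ge0 k x : (0 <= (`|w x| * `|k x|)%:E)%E by rewrite lee_fin mulr_ge0.
rewrite -ge0_integralD//; [|exact: measurable_wnorm|exact: measurable_wnorm].
apply: ge0_le_integral => //.
- exact: measurable_wnorm.
- by apply: emeasurable_funD; exact: measurable_wnorm.
- by move=> x _; rewrite -EFinD lee_fin -mulrDr ler_wpM2l.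
Qed.

#[local] Lemma wnorm_cvg (f_ : nat -> 'rV[R]_n -> R) f :
  (forall k, measurable_fun setT (f_ k)) -> measurable_fun setT f ->
  (forall k x, 0 <= f_ k x <= 1) -> (forall x, 0 <= f x <= 1) ->
  (forall x, f_ k x @[k --> \oo] --> f x) ->
  wnorm (fun x => f x - f_ k x) @[k --> \oo] --> 0%E.
Proof.
move=> mf_ mf f_01 f01 cf.
rewrite -(integral0 mu setT).
apply: (@dominated_cvg _ _ _ mu _ measurableT _ _ (EFin \o (fun x => `|w x|))).
- by move=> k; apply: measurable_wnorm; exact: measurable_funB.
- move=> x _; apply/cvg_EFin; first by near=> k.
  rewrite -[X in _ --> X](mulr0 `|w x|); apply: cvgM; first exact: cvg_cst.
  rewrite -(normr0 R); apply: cvg_norm; rewrite -(subrr (f x)).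
  by apply: cvgB; [exact: cvg_cst|exact: cf].
- by [].
- have := integrable_abse iw; apply: eq_integrable => //.
- move=> k x _; rewrite lee_fin normrM !normr_id ler_piMr//.
  have := f_01 k x; have := f01 x; rewrite ler_norml; lra.
Unshelve. all: by end_near. Qed.

(** Approximation in the seminorm of the measure $|w| dx$, by test functions
    with values in the unit interval: the last constraint is what allows signs
    to be approximated without losing the bound 1. *)
Definition approximable f : Prop := forall e : R, 0 < e ->
  exists g, [/\ test_fun g, (forall x, 0 <= g x <= 1) &
    (wnorm (fun x => (f x - g x)%R) < e%:E)%E].

(** Stability under pointwise limits, from dominated convergence; it is the only
    way in which limits enter the construction of approximable sets. *)
#[local] Lemma approximable_lim (f_ : nat -> 'rV[R]_n -> R) f :
  (forall k, measurable_fun setT (f_ k)) -> measurable_fun setT f ->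
  (forall k x, 0 <= f_ k x <= 1) -> (forall x, 0 <= f x <= 1) ->
  (forall x, f_ k x @[k --> \oo] --> f x) ->
  (forall k, approximable (f_ k)) -> approximable f.
Proof.
move=> mf_ mf f_01 f01 cf af e e0.
have e20 : 0 < e / 2 by rewrite divr_gt0.
have e2E : (0 < (e / 2)%:E)%E by rewrite lte_fin.
have [k _ /(_ k (leqnn k))/= Ik] :=
  wnorm_cvg mf_ mf f_01 f01 cf (open_ereal_lt' e2E).
have [g [Tg g01 Ig]] := af k _ e20.
exists g; split => //.
have mg := test_fun_measurable Tg.
apply: (@le_lt_trans _ _ (wnorm (fun x => (f x - f_ k x)%R) +
  wnorm (fun x => (f_ k x - g x)%R))%E).
  apply: wnorm_triangle; [exact: measurable_funB|exact: measurable_funB|exact: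
    measurable_funB|].
  by move=> x; rewrite -[X in X <= _](_ : `|f x - f_ k x +
    (f_ k x - g x)| = _) ?ler_normD// addrA subrK.
by rewrite [e]splitr EFinD lteD.
Qed.

Let ind A x : R := \1_A x.

#[local] Lemma ind01 A x : 0 <= ind A x <= 1.
Proof. by rewrite /ind indicE; case: (_ \in _); rewrite /= ?lexx ?ler01. Qed.

#[local] Hint Resolve ind01 : core.

#[local] Lemma measurable_ind A : measurable A -> measurable_fun setT (ind A).
Proof. exact: measurable_indic. Qed.

#[local] Lemma cvg_indic (A_ : nat -> set 'rV[R]_n) A x :
  (\forall k \near \oo, A_ k x <-> A x) ->
  ind (A_ k) x @[k --> \oo] --> ind A x.
Proof.
move=> AA; apply: cvg_near_cst; near=> k.
rewrite /ind !indicE; congr (_%:R); congr (nat_of_bool _).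
by apply/idP/idP; rewrite !inE; near: k; apply: filterS AA => k [].
Unshelve. all: by end_near. Qed.

Let D := [set A | measurable A /\ approximable (ind A)].

#[local] Lemma approx_box (a b : 'I_n -> R) : (forall i, a i < b i) ->
  D (rectangle (fun i => `]a i, b i[%classic)).
Proof.
move=> ab; have mB : measurable (rectangle (fun i => `]a i, b i[%classic)).
  by apply: measurable_rectangle => i; exact: measurable_itv.
split => //.
pose f_ k (x : 'rV[R]_n) : R := \prod_(i < n) bump (a i) (b i) k (x ord0 i).
have Tf k : test_fun (f_ k).
  apply: eq_test_fun (test_tensor 1 (f := fun i => bump (a i) (b i) k) _) =>
    [x|i].
    by rewrite mul1r.
  exact: bump_C1c.
have f01 k x : 0 <= f_ k x <= 1.
  rewrite /f_ prodr_ge0/= => [|i _]; last exact: bump_ge0.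
  by apply: prodr_ile1 => i _; rewrite bump_ge0 bump_le1.
apply: (@approximable_lim f_) => //.
- by move=> k; exact: test_fun_measurable.
- exact: measurable_ind.
- move=> x.
  have -> : ind (rectangle (fun i => `]a i, b i[%classic)) x =
      \prod_(i < n) (\1_(`]a i, b i[%classic) (x ord0 i) : R).
    rewrite /ind indicE.
    have [xB|xB] := pselect (rectangle (fun i => `]a i, b i[%classic) x).
      rewrite mem_set// big1// => i _; rewrite indicE mem_set//; exact: xB.
    rewrite memNset//; have /existsNP[i xi] : ~ forall i, `]a i,
      b i[%classic (x ord0 i).
      exact.
    by rewrite (bigD1 i)//= indicE memNset// mul0r.
  have cB : \prod_(i < n) bump (a i) (b i) k (x ord0 i) @[k --> \oo] -->
      \prod_(i < n) (\1_(`]a i, b i[%classic) (x ord0 i) : R).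
    apply: cvg_big => [|i _]; first exact: mul_continuous.
    exact: bump_cvg.
  exact: cB.
move=> k e e0; exists (f_ k); split => //.
rewrite (_ : (fun x => _) = cst 0%E) ?integral0 ?lte_fin//.
by apply/funext => x; rewrite subrr normr0 mulr0.
Qed.

#[local] Lemma approx_slab (i : 'I_n) (a b : R) : a < b ->
  D [set v : 'rV[R]_n | `]a, b[%classic (v ord0 i)].
Proof.
move=> ab.
pose lo k j : R := if j == i then a else - (k.+1)%:R.
pose hi k j : R := if j == i then b else (k.+1)%:R.
have lh k j : lo k j < hi k j.
  rewrite /lo /hi; case: ifP => // _.
  by rewrite (@lt_trans _ _ 0)// ?oppr_lt0 ltr0n.
pose B k := rectangle (fun j => `]lo k j, hi k j[%classic).
have mS : measurable [set v : 'rV[R]_n | `]a, b[%classic (v ord0 i)].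
  rewrite -[X in measurable X]setTI.
  exact: (measurable_rV_coord i measurableT (measurable_itv `]a, b[)).
split => //; apply: (@approximable_lim (fun k => ind (B k))) => //.
- by move=> k; apply: measurable_ind; have [] := approx_box (lh k).
- exact: measurable_ind.
- move=> x; apply: cvg_indic; near=> k; split.
    by move=> /(_ i); rewrite /lo /hi eqxx.
  move=> xab j; rewrite /lo /hi; case: eqP => [->//|_].
  rewrite /= in_itv/= -ltr_norml.
  apply: (@le_lt_trans _ _ (\sum_l `|x ord0 l|)).
    by rewrite (bigD1 j)//= lerDl sumr_ge0.
  apply: (@le_lt_trans _ _ k%:R); last by rewrite ltr_nat.
  by near: k; exact: nbhs_infty_ger.
- by move=> k; have [] := approx_box (lh k).
Unshelve. all: by end_near. Qed.

#[local] Lemma approx_setT : D setT.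
Proof.
split => //.
pose B k := rectangle (fun j : 'I_n => `]- (k.+1%:R : R), (k.+1%:R : R)[%classic).
have lh k (j : 'I_n) : - (k.+1)%:R < (k.+1)%:R :> R.
  by rewrite (@lt_trans _ _ 0)// ?oppr_lt0 ltr0n.
apply: (@approximable_lim (fun k => ind (B k))) => //.
- by move=> k; apply: measurable_ind; have [] := approx_box (lh k).
- exact: measurable_ind.
- move=> x; apply: cvg_indic; near=> k; split => // _ j.
  rewrite /= in_itv/= -ltr_norml.
  apply: (@le_lt_trans _ _ (\sum_l `|x ord0 l|)).
    by rewrite (bigD1 j)//= lerDl sumr_ge0.
  apply: (@le_lt_trans _ _ k%:R); last by rewrite ltr_nat.
  by near: k; exact: nbhs_infty_ger.
- by move=> k; have [] := approx_box (lh k).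
Unshelve. all: by end_near. Qed.

#[local] Lemma approx_set0 : D set0.
Proof.
split => // e e0; exists (fun x => 0 * \prod_(j < n) (bump 0 1 0 (x ord0 j) :
  R)); split.
- by apply: (test_tensor 0 (f := fun=> bump 0 1 0)) => j; apply: bump_C1c;
    exact: ltr01.
- by move=> x; rewrite mul0r lexx ler01.
- rewrite (_ : (fun x => _) = cst 0%E) ?integral0 ?lte_fin//.
  by apply/funext => x; rewrite mul0r subr0 /ind indic0 normr0 mulr0.
Qed.

(** Since the constant 1 need not be a test function, $1 - g$ is replaced by
    $h - hg$ with h approximating 1. *)
#[local] Lemma approx_setC A : D A -> D (~` A).
Proof.
move=> [mA aA]; split; first exact: measurableC.
move=> e e0; have e20 : 0 < e / 2 by rewrite divr_gt0.
have [g [Tg g01 Ig]] := aA _ e20.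
have [h [Th h01 Ih]] := approx_setT.2 _ e20.
have mg := test_fun_measurable Tg; have mh := test_fun_measurable Th.
exists (fun x => h x - h x * g x); split.
- by apply: test_funB => //; exact: test_funM.
- by move=> x; have := g01 x; have := h01 x; nra.
- apply: (@le_lt_trans _ _ (wnorm (fun x => (ind A x - g x)%R) +
    wnorm (fun x => (ind setT x - h x)%R))%E).
    apply: wnorm_triangle.
    + by apply: measurable_funB => //; exact: measurable_ind.
    + by apply: measurable_funB => //; exact: measurable_ind.
    + apply: measurable_funB; first by apply: measurable_ind; exact: measurableC.
      by apply: measurable_funB => //; exact: measurable_funM.
    + move=> x; rewrite /ind indicC/= indicT !indicE /=.
      have := g01 x; have := h01 x; case: (x \in A) => /= h1 g1.
        rewrite (ger0_norm (x := _ - g x)) ?(ger0_norm (x := _ - h x));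
          [|lra|lra].
        by rewrite ler_norml; nra.
      rewrite (ler0_norm (x := _ - g x)) ?(ger0_norm (x := _ - h x)); [|lra|lra].
      by rewrite ler_norml; nra.
  by rewrite [e]splitr EFinD lteD.
Qed.

(** $g + h - gh$ is the union of functions with values in the unit interval. *)
#[local] Lemma approx_setU A B : D A -> D B -> D (A `|` B).
Proof.
move=> [mA aA] [mB aB]; split; first exact: measurableU.
move=> e e0; have e20 : 0 < e / 2 by rewrite divr_gt0.
have [g [Tg g01 Ig]] := aA _ e20.
have [h [Th h01 Ih]] := aB _ e20.
have mg := test_fun_measurable Tg; have mh := test_fun_measurable Th.
exists (fun x => g x + h x - g x * h x); split.
- by apply: test_funB; [exact: test_funD|exact: test_funM].
- by move=> x; have := g01 x; have := h01 x; nra.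
- apply: (@le_lt_trans _ _ (wnorm (fun x => (ind A x - g x)%R) +
    wnorm (fun x => (ind B x - h x)%R))%E).
    apply: wnorm_triangle.
    + by apply: measurable_funB => //; exact: measurable_ind.
    + by apply: measurable_funB => //; exact: measurable_ind.
    + apply: measurable_funB; first by apply: measurable_ind; exact: measurableU.
      by apply: measurable_funB; [exact: measurable_funD|exact: measurable_funM].
    + move=> x; rewrite /ind !indicE in_setU.
      have := g01 x; have := h01 x; case: (x \in A); case: (x \in B) => /= h1 g1;
      [ rewrite (ger0_norm (x := _ - g x)) ?(ger0_norm (x := _ - h x)); [|lra|lra]
      | rewrite (ger0_norm (x := _ - g x)) ?(ler0_norm (x := _ - h x)); [|lra|lra]
      | rewrite (ler0_norm (x := _ - g x)) ?(ger0_norm (x := _ - h x)); [|lra|lra]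
      | rewrite (ler0_norm (x := _ - g x)) ?(ler0_norm (x := _ - h x));
        [|lra|lra] ];
      rewrite ler_norml; nra.
  by rewrite [e]splitr EFinD lteD.
Qed.

#[local] Lemma approx_sigma_algebra : sigma_algebra setT D.
Proof.
split; first exact: approx_set0.
  by move=> A DA; rewrite setTD; exact: approx_setC.
move=> A DA.
have DU k : D (\big[setU/set0]_(i < k) A i).
  by apply: big_ind => //; [exact: approx_set0|exact: approx_setU].
have mU : measurable (\bigcup_k A k) by apply: bigcup_measurable => k _;
  have [] := DA k.
split => //; apply: (@approximable_lim (fun k =>
  ind (\big[setU/set0]_(i < k) A i))) => //.
- by move=> k; apply: measurable_ind; have [] := DU k.
- exact: measurable_ind.
- move=> x; apply: cvg_indic.
  have [[k _ Akx]|nx] := pselect ((\bigcup_k A k) x).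
    near=> m; split=> [_|_]; first by exists k.
    rewrite -bigcup_mkord; exists k => //=.
    by near: m; exact: nbhs_infty_gt.
  by near=> m; split => //; rewrite -bigcup_mkord => -[k _ Akx]; exists k.
- by move=> k; have [] := DU k.
Unshelve. all: by end_near. Qed.

Lemma approximable_indic A : measurable A -> approximable (fun x => \1_A x).
Proof.
move=> mA; suff [] : D A by [].
rewrite -(sigma_algebra_id approx_sigma_algebra); apply: borel_sub_generated mA.
move=> i B [a [b ->]]; rewrite (sigma_algebra_id approx_sigma_algebra).
have [ab|ba] := ltP a b; first exact: approx_slab.
rewrite set_itv_ge ?bnd_simp -?leNgt//.
by rewrite (_ : [set v | _] = set0)//; exact: approx_set0.
Qed.

(** Approximate the indicators of the sets where w is positive and negative by
    g and h; the test function $g - h$ then approximates the sign of w, and the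
    pointwise inequality $|w| \le w(g-h) + |w||1_A-g| + |w||1_B-h|$ concludes. *)
Lemma integral_norm_le_of_test (C : \bar R) :
  (forall g, test_fun g -> (forall x, `|g x| <= 1) ->
    (\int[mu]_x (w x * g x)%:E <= C)%E) ->
  (\int[mu]_x `|w x|%:E <= C)%E.
Proof.
move=> wC; apply/lee_addgt0Pr => e e0.
have e20 : 0 < e / 2 by rewrite divr_gt0.
pose A := [set x | 0 < w x]; pose B := [set x | w x < 0].
have mA : measurable A.
  rewrite (_ : A = w @^-1` `]0, +oo[%classic); last first.
    by apply/seteqP; split => x; rewrite /= in_itv/= andbT.
  by rewrite -[X in measurable X]setTI; exact: (integrable_measurable iw).
have mB : measurable B.
  rewrite (_ : B = w @^-1` `]-oo, 0[%classic); last first.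
    by apply/seteqP; split => x; rewrite /= in_itv.
  by rewrite -[X in measurable X]setTI; exact: (integrable_measurable iw).
have [g [Tg g01 Ig]] := approximable_indic mA e20.
have [h [Th h01 Ih]] := approximable_indic mB e20.
have mg := test_fun_measurable Tg; have mh := test_fun_measurable Th.
have gh1 x : `|g x - h x| <= 1.
  by have := g01 x; have := h01 x; rewrite ler_norml; lra.
have iI (E : set 'rV[R]_n) (k : 'rV[R]_n -> R) : measurable E ->
  measurable_fun setT k -> (forall x, 0 <= k x <= 1) ->
    mu.-integrable setT (fun x => (`|w x| * `|\1_E x - k x|)%:E).
  move=> mE mk k01.
  apply: (integrable_mul_bounded (u := fun x => `|w x|) (M := 1)).
  - by have := integrable_abse iw; apply: eq_integrable.
  - by apply: measurableT_comp => //; apply: measurable_funB => //; exact: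
      measurable_ind.
  - move=> x; rewrite normr_id ler_norml; have := k01 x.
    by have := ind01 E x; rewrite /ind; lra.
have iwgh : mu.-integrable setT (fun x => (w x * (g x - h x))%:E).
  by apply: (integrable_mul_bounded (M := 1)) => //; exact: measurable_funB.
apply: (@le_trans _ _ (\int[mu]_x ((w x * (g x - h x))%:E +
    ((`|w x| * `|\1_A x - g x|)%:E + (`|w x| * `|\1_B x - h x|)%:E)))%E).
  apply: le_integral => //.
  - by have := integrable_abse iw; apply: eq_integrable.
  - by apply: integrableD => //; apply: integrableD => //; exact: iI.
  move=> x _; rewrite -!EFinD lee_fin.
  have [w0|w0|w0] := ltgtP (w x) 0.
  - have -> : \1_A x = 0 :> R by rewrite indicE memNset// /A /=; lra.
    have -> : \1_B x = 1 :> R by rewrite indicE mem_set.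
    have := g01 x; have := h01 x => hx gx.
    rewrite ltr0_norm// sub0r normrN !ger0_norm; [nra|lra|lra].
  - have -> : \1_A x = 1 :> R by rewrite indicE mem_set.
    have -> : \1_B x = 0 :> R by rewrite indicE memNset// /B /=; lra.
    have := g01 x; have := h01 x => hx gx.
    rewrite gtr0_norm// sub0r normrN !ger0_norm; [nra|lra|lra].
  - by rewrite w0 normr0 !mul0r !addr0.
rewrite integralD//; last by apply: integrableD => //; exact: iI.
apply: leeD; first by apply: wC => //; exact: test_funB.
rewrite integralD//; [|exact: iI|exact: iI].
by rewrite [e]splitr EFinD; apply: leeD; exact: ltW.
Qed.

End density.

Section translation_estimate.
Context {R : realType} {n : nat}.
Local Notation mu := (@lebesgue_rV R n).
Lemma integral_increment_le (u : 'rV[R]_n -> R) (i : 'I_n) (t : R) :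
  mu.-integrable setT (EFin \o u) -> 0 < t ->
  (\int[mu]_x `|u x - u (x + t *: delta_mx ord0 i)|%:E <=
    t%:E * total_variation u)%E.
Proof.
move=> iu t0; apply: integral_norm_le_of_test.
  exact: (integrableB measurableT iu (integrable_shift (t *:
    delta_mx ord0 i) iu)).
by move=> g Tg g1; exact: integral_increment_test_le.
Qed.

End translation_estimate.

(** * Cube averages and tails *)

Section averaging.
Context {R : realType} {n : nat}.
Local Notation mu := (@lebesgue_rV R n).
Variables (u : 'rV[R]_n -> R) (V : R).
Hypothesis iu : mu.-integrable setT (EFin \o u).
Hypotheses (V0 : 0 <= V) (uV : (total_variation u <= V%:E)%E).

Definition cube (d : R) : set 'rV[R]_n := rectangle (fun=> `[0, d]%classic).

Lemma measurable_cube d : measurable (cube d).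
Proof. by apply: measurable_rectangle => i; exact: measurable_itv. Qed.

Lemma lebesgue_cube d : 0 <= d -> mu (cube d) = (d ^+ n)%:E.
Proof.
move=> d0.
have -> : mu (cube d) = (\prod_(i < n) lebesgue_measure (`[0%R, d]%classic :
  set R))%E.
  by apply: (lebesgue_rV_prod (A := fun=> `[0%R, d]%classic)) => i; exact:
    measurable_itv.
rewrite (eq_bigr (fun=> d%:E)) => [|i _].
  by rewrite prodEFin prodr_const card_ord.
rewrite lebesgue_measure_itv/= lte_fin; case: ltP => [_|d0'].
  by rewrite -EFinB subr0.
by congr EFin; apply/eqP; rewrite eq_le d0 d0'.
Qed.

#[local] Lemma measurable_increment (h : 'rV[R]_n) :
  measurable_fun setT (fun x => `|u x - u (x + h)|%:E).
Proof.
apply/measurable_EFinP; apply: measurableT_comp => //.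
apply: measurable_funB; first exact: (integrable_measurable iu).
exact: (measurableT_comp (integrable_measurable iu) (measurable_shift h)).
Qed.

Lemma integral_increment_add (h k : 'rV[R]_n) :
  (\int[mu]_x `|u x - u (x + (h + k))|%:E <=
   \int[mu]_x `|u x - u (x + h)|%:E + \int[mu]_x `|u x - u (x + k)|%:E)%E.
Proof.
rewrite -[X in (_ + X)%E](ge0_integral_shift h (measurable_increment k))//.
have mk : measurable_fun setT (fun x : 'rV[R]_n => `|u (x + h) - u (x + h +
  k)|%:E).
  exact: (measurableT_comp (measurable_increment k) (measurable_shift h)).
rewrite -ge0_integralD//; [|exact: measurable_increment].
apply: ge0_le_integral => //.
- exact: measurable_increment.
- by apply: emeasurable_funD => //; exact: measurable_increment.
- by move=> x _; rewrite -EFinD lee_fin addrA -[leLHS](_ : `|u x - u (x +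
    h) + (u (x + h) - u (x + h + k))| = _) ?ler_normD// subrKA.
Qed.

(** Decompose z into steps along the axes; each step is estimated at a translate
    of u, which costs nothing by translation invariance. *)
Lemma integral_increment_cube d z : 0 <= d -> cube d z ->
  (\int[mu]_x `|u x - u (x + z)|%:E <= (n%:R * d * V)%:E)%E.
Proof.
move=> d0 zd.
suff H (s : seq 'I_n) :
    (\int[mu]_x `|u x - u (x + \sum_(i <- s) z ord0 i *: delta_mx ord0 i)|%:E
      <= ((size s)%:R * d * V)%:E)%E.
  rewrite [z]row_sum_delta; have := H (index_enum 'I_n).
  have -> : size (index_enum 'I_n) = n by rewrite -[RHS]card_ord cardT enumT.
  exact.
elim: s => [|i s IH].
  rewrite big_nil /= !mul0r (_ : (fun x => _) = cst 0%E) ?integral0//.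
  by apply/funext => x; rewrite addr0 subrr normr0.
rewrite big_cons /=; apply: le_trans (integral_increment_add _ _) _.
rewrite -natr1 addrC mulrDl mulrDl mul1r EFinD; apply: leeD => //.
have := zd i; rewrite /= in_itv/= => /andP[]; rewrite le_eqVlt =>
  /predU1P[<- _|zi0 zid].
  rewrite (_ : (fun x => _) = cst 0%E) ?integral0 ?lee_fin ?mulr_ge0//.
  by apply/funext => x; rewrite scale0r addr0 subrr normr0.
apply: le_trans (integral_increment_le i iu zi0) _.
apply: (@le_trans _ _ ((z ord0 i)%:E * V%:E)%E).
  by apply: lee_wpmul2l => //; rewrite lee_fin ltW.
by rewrite -EFinM lee_fin ler_wpM2r.
Qed.

#[local] Lemma measurable_increments :
  measurable_fun setT (fun p : 'rV[R]_n * 'rV[R]_n => `|u p.1 - u (p.1 + p.2)|).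
Proof.
have mf1 : measurable_fun [set: 'rV[R]_n * 'rV[R]_n] (fun p => u p.1).
  exact: (measurableT_comp (integrable_measurable iu) measurable_fst).
have madd : measurable_fun [set: 'rV[R]_n * 'rV[R]_n] (fun p => p.1 + p.2).
  apply: measurable_fun_rV => i; under eq_fun do rewrite mxE.
  apply: measurable_funD.
    exact: (measurableT_comp (measurable_rV_coord i) measurable_fst).
  exact: (measurableT_comp (measurable_rV_coord i) measurable_snd).
apply: measurableT_comp => //; apply: measurable_funB => //.
exact: (measurableT_comp (integrable_measurable iu) madd).
Qed.

(** On the set where $|u| > l$ the average of $|u|$ over the cube based at the
    point is less than half of $|u|$ there, so that u differs from its
    translates by at least half its size on average.  Exchanging integrals turns
    this into the translation estimate. *)
Lemma tail_integral_le_variation (l d : R) : 0 < l -> 0 < d ->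
  (forall x, \int[mu]_(z in cube d) `|u (x + z)|%:E <= (d ^+ n * (l / 2))%:E)%E ->
  (\int[mu]_(x in [set x | (l < `|u x|)%R]) `|u x|%:E <= (2 * n%:R * d * V)%:E)%E.
Proof.
move=> l0 d0 ud.
have mQ := measurable_cube d.
have c0 : 0 < d ^+ n by rewrite exprn_gt0.
pose F (p : 'rV[R]_n * 'rV[R]_n) : \bar R :=
  (`|u p.1 - u (p.1 + p.2)| * \1_(cube d) p.2)%:E.
have mF : measurable_fun setT F.
  apply/measurable_EFinP; apply: measurable_funM; first exact:
    measurable_increments.
  exact: (measurableT_comp (measurable_indic mQ) measurable_snd).
have F0 p : (0 <= F p)%E by rewrite lee_fin mulr_ge0.
have muu : measurable_fun setT (fun x => `|u x|%:E).
  by apply/measurable_EFinP; apply: measurableT_comp => //; exact: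
    (integrable_measurable iu).
have mE : measurable [set x | l < `|u x|].
  rewrite (_ : [set x | _] = (fun x => `|u x|) @^-1` `]l, +oo[%classic);
    last first.
    by apply/seteqP; split => x; rewrite /= in_itv/= andbT.
  rewrite -[X in measurable X]setTI.
  by apply: (measurableT_comp _ (integrable_measurable iu) measurableT) => //;
    exact: measurable_itv.
pose G x := (\int[mu]_z F (x, z))%E.
have FG : (\int[mu]_x G x <= (d ^+ n * (n%:R * d * V))%:E)%E.
  rewrite /G (fubini_tonelli F mF F0).
  apply: (@le_trans _ _ (\int[mu]_z ((n%:R * d * V) * \1_(cube d) z)%:E)%E).
    apply: ge0_le_integral => //.
    - by move=> z _; apply: integral_ge0 => x _.
    - exact: measurable_fun_fubini_tonelli_G.
    - by apply/measurable_EFinP; apply: measurable_funM => //; exact: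
        measurable_indic.
    - move=> z _; rewrite /F /= indicE.
      have [zQ|zQ] := pselect (cube d z).
        rewrite mem_set// mulr1; under eq_integral do rewrite mulr1.
        by apply: integral_increment_cube => //; exact: ltW.
      rewrite memNset// mulr0; under eq_integral do rewrite mulr0.
      by rewrite integral0.
  under eq_integral do rewrite EFinM.
  rewrite ge0_integralZl//; last first.
  - by rewrite lee_fin !mulr_ge0// ltW.
  - by apply/measurable_EFinP; exact: measurable_indic.
  by rewrite integral_indic// setIT [X in (_ * X)%E](lebesgue_cube (ltW d0))
    -EFinM mulrC.
(* At least half of |u x| is left once the mean of |u| is subtracted. *)
have EG x : l < `|u x| -> ((d ^+ n / 2)%:E * `|u x|%:E <= G x)%E.
  move=> lx.
  have muxz : measurable_fun setT (fun z : 'rV[R]_n => `|u (x + z)|%:E).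
    have -> : (fun z => `|u (x + z)|%:E) = (fun y => `|u y|%:E) \o (fun z =>
      z + x).
      by apply/funext => z; rewrite /= addrC.
    exact: (measurableT_comp muu (measurable_shift x)).
  have mdxz : measurable_fun setT (fun z : 'rV[R]_n => `|u x - u (x + z)|%:E).
    apply/measurable_EFinP; apply: measurableT_comp => //; apply:
      measurable_funB => //.
    have -> : (fun z => u (x + z)) = u \o (fun z => z + x).
      by apply/funext => z; rewrite /= addrC.
    exact: (measurableT_comp (integrable_measurable iu) (measurable_shift x)).
  have GE : G x = (\int[mu]_(z in cube d) `|u x - u (x + z)|%:E)%E.
    rewrite /G [RHS]integral_mkcond; apply: eq_integral => z _.
    rewrite /F /= patchE indicE; case: (z \in cube d); first by rewrite mulr1.
    by rewrite mulr0.
  have H : ((d ^+ n)%:E * `|u x|%:E <= G x + (d ^+ n * (l / 2))%:E)%E.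
    apply: le_trans (leeD2l (G x) (ud x)).
    rewrite GE -ge0_integralD//; [|exact: measurable_funTS|exact:
      measurable_funTS].
    have -> : ((d ^+ n)%:E * `|u x|%:E)%E = (\int[mu]_(z in cube d) `|u x|%:E)%E.
      rewrite integral_cst// [RHS]muleC; congr (_ * _)%E.
      exact/esym/(lebesgue_cube (ltW d0)).
    apply: ge0_le_integral => //.
    - by apply: emeasurable_funD; exact: measurable_funTS.
    - by move=> z _; rewrite -EFinD lee_fin -{1}(subrK (u (x +
        z)) (u x)) ler_normD.
  have : (0 <= G x)%E by apply: integral_ge0 => z _; exact: F0.
  move: H; case: (G x) => [g| |]//; last first.
    by move=> _ _; rewrite leey.
  rewrite -!EFinM -EFinD !lee_fin => H _.
  have := ler_wpM2l (ltW c0) (ltW lx); lra.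
rewrite -(@lee_pmul2l _ (d ^+ n / 2)%:E)//; last by rewrite lte_fin divr_gt0.
rewrite -ge0_integralZl//; [|exact: measurable_funTS|by rewrite lee_fin
  divr_ge0// ltW].
rewrite -EFinM (_ : d ^+ n / 2 * _ = d ^+ n * (n%:R * d * V)); last by field.
apply: le_trans FG.
apply: (@le_trans _ _ (\int[mu]_(x in [set x | (l < `|u x|)%R]) G x)%E).
  apply: ge0_le_integral => //.
  - by move=> x _; rewrite mule_ge0// lee_fin divr_ge0// ltW.
  - by apply: measurable_funeM; exact: measurable_funTS.
  - by apply: measurable_funTS; exact: measurable_fun_fubini_tonelli_F.
apply: ge0_subset_integral => //.
- exact: measurable_fun_fubini_tonelli_F.
- by move=> x _; apply: integral_ge0.
Qed.

End averaging.

(** * Cubes inside balls *)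

Section local_to_global.
Context {R : realType} {n : nat}.
Local Notation mu := (@lebesgue_rV R n).
Lemma measurable_enorm (y : 'rV[R]_n) :
  measurable_fun setT (fun x : 'rV[R]_n => enorm (x - y)).
Proof.
have msqrt : measurable_fun setT (@Num.sqrt R).
  by apply: continuous_measurable_fun; exact: sqrt_continuous.
apply: (measurableT_comp msqrt).
apply: measurable_sum => i; apply: measurable_funX.
exact: (measurableT_comp (measurable_rV_coord i) (measurable_shift (- y))).
Qed.

Lemma measurable_eball (y : 'rV[R]_n) (r : R) : measurable (eball y r).
Proof.
rewrite (_ : eball y r = (fun x => enorm (x - y)) @^-1` `]-oo, r[%classic);
  last first.
  by apply/seteqP; split => x; rewrite /eball /= in_itv.
by rewrite -[X in measurable X]setTI; apply: measurable_enorm => //; exact: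
  measurable_itv.
Qed.

Lemma cube_sub_eball (x z : 'rV[R]_n) (d r : R) : 0 <= d -> n%:R * d < r ->
  cube d z -> eball x r (x + z).
Proof.
move=> d0 dr zd; apply: le_lt_trans dr; rewrite addrAC subrr add0r /enorm.
have nd0 : 0 <= n%:R * d by rewrite mulr_ge0.
rewrite -[leRHS](ger0_norm nd0) -sqrtr_sqr ler_wsqrtr//.
apply: (@le_trans _ _ (\sum_(i < n) d ^+ 2)).
  apply: ler_sum => i _; have := zd i; rewrite /= in_itv/= => /andP[z0 zd'].
  by rewrite ler_pXn2r// nnegrE.
rewrite sumr_const card_ord -[leLHS]mulr_natl exprMn ler_wpM2r ?sqr_ge0//.
by rewrite -natrX ler_nat; case: n => // k; rewrite -mulnn leq_pmulr.
Qed.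

(** A substitute for Jensen's inequality: optimising in a would give back the
    power mean, up to a constant. *)
Lemma le_add_powR (p a t : R) : 1 <= p -> 0 < a -> 0 <= t ->
  t <= a + a / a `^ p * t `^ p.
Proof.
move=> p1 a0 t0.
have ap0 : 0 < a `^ p by rewrite powR_gt0.
have [ta|at_] := leP t a.
  by apply: le_trans ta _; rewrite lerDl mulr_ge0 ?powR_ge0// divr_ge0// ltW.
have h : t / a <= (t / a) `^ p.
  by rewrite le1r_powR// ler_pdivlMr// mul1r ltW.
have E : a / a `^ p * t `^ p = a * (t / a) `^ p.
  rewrite powRM//; last by rewrite invr_ge0 ltW.
  rewrite -[a^-1]powR_inv1 ?(ltW a0)// -powRrM mulN1r powRN; ring.
rewrite E; apply: (@le_trans _ _ (a * (t / a) `^ p)); last by rewrite lerDr ltW.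
by rewrite -ler_pdivrMl// mulrC.
Qed.

Lemma cube_integral_le_power (u : 'rV[R]_n -> R) (x : 'rV[R]_n) (r d p a M : R) :
  measurable_fun setT u -> 0 < d -> n%:R * d < r -> 1 <= p -> 0 < a ->
  (\int[mu]_(y in eball x r) (`|u y| `^ p)%:E <= M%:E)%E ->
  (\int[mu]_(z in cube d) `|u (x + z)|%:E <=
    (d ^+ n * a + a / a `^ p * M)%:E)%E.
Proof.
move=> mu_ d0 dr p1 a0 uM.
have mQ : measurable (cube d : set 'rV[R]_n) by exact: measurable_cube.
have ap0 : 0 <= a / a `^ p by rewrite divr_ge0 ?powR_ge0 ?ltW.
have mup : measurable_fun setT (fun y => (`|u y| `^ p)%:E).
  apply/measurable_EFinP.
  apply: (measurableT_comp (f := fun y => y `^ p)); first exact: measurable_powR.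
  exact: measurableT_comp.
have mux : measurable_fun setT (fun z : 'rV[R]_n => u (x + z)).
  have -> : (fun z => u (x + z)) = u \o (fun z => z + x).
    by apply/funext => z; rewrite /= addrC.
  exact: (measurableT_comp mu_ (measurable_shift x)).
have muxp : measurable_fun setT (fun z : 'rV[R]_n => (`|u (x + z)| `^ p)%:E).
  apply/measurable_EFinP.
  apply: (measurableT_comp (f := fun y => y `^ p)); first exact: measurable_powR.
  exact: measurableT_comp.
apply: (@le_trans _ _ (\int[mu]_(z in cube d)
    (a%:E + (a / a `^ p)%:E * (`|u (x + z)| `^ p)%:E))%E).
  apply: ge0_le_integral => //.
  - apply/measurable_EFinP; apply: measurable_funTS; exact: measurableT_comp.
  - apply: emeasurable_funD; first exact: measurable_cst.
    by apply: measurable_funeM; exact: measurable_funTS.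
  - by move=> z _; rewrite -EFinM -EFinD lee_fin le_add_powR.
rewrite ge0_integralD//; last 3 first.
- by move=> z _; rewrite lee_fin ltW.
- by move=> z _; rewrite -EFinM lee_fin mulr_ge0 ?powR_ge0.
- by apply: measurable_funeM; exact: measurable_funTS.
rewrite EFinD; apply: leeD.
  rewrite integral_cst// EFinM muleC; apply: lee_wpmul2r;
    first by rewrite lee_fin ltW.
  by rewrite le_eqVlt; apply/orP; left; apply/eqP; exact/lebesgue_cube/ltW.
rewrite ge0_integralZl//; last exact: measurable_funTS.
rewrite [leRHS]EFinM; apply: lee_wpmul2l; first by rewrite lee_fin.
apply: le_trans uM.
rewrite integral_mkcond [leRHS]integral_mkcond.
rewrite -[leRHS](ge0_integral_shift x); last 2 first.
- apply/(measurable_restrictT _ (measurable_eball x r)); exact: measurable_funTS.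
- by move=> y; rewrite patchE; case: ifP => _; rewrite // lee_fin powR_ge0.
apply: ge0_le_integral => //.
- by move=> z _; rewrite patchE; case: ifP => _; rewrite // lee_fin powR_ge0.
- by apply/(measurable_restrictT _ mQ); exact: measurable_funTS.
- apply: (measurableT_comp _ (measurable_shift x)).
  apply/(measurable_restrictT _ (measurable_eball x r)); exact: measurable_funTS.
- move=> z _; rewrite !patchE.
  case: ifPn => [|_]; last by case: ifPn; rewrite // lee_fin powR_ge0.
  rewrite inE => zd; rewrite mem_set; first by rewrite addrC.
  by rewrite addrC; apply: cube_sub_eball dr zd; exact: ltW.
Qed.

End local_to_global.

(** * From local p-th powers to global s-th powers *)

Section global_power_integral_le.
Context {R : realType} {n : nat}.
Local Notation mu := (@lebesgue_rV R n).
Hypothesis n0 : (0 < n)%N.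
Variables (u : 'rV[R]_n -> R) (V A r d0 p l0 : R).
Hypothesis iu : mu.-integrable setT (EFin \o u).
Hypotheses (V0 : 0 <= V) (uV : (total_variation u <= V%:E)%E).
Hypotheses (uA : (\int[mu]_x `|u x|%:E <= A%:E)%E).
Hypotheses (d00 : 0 < d0) (d0r : n%:R * d0 < r) (p1 : 1 <= p) (l00 : 0 < l0).
Hypothesis uloc : forall y,
  (\int[mu]_(x in eball y r) (`|u x| `^ p)%:E <= (d0 ^+ n * (l0 / 4) `^ p)%:E)%E.

(** The side d of the cubes is chosen so that the local bound scales to
    $d^n (l/4)^p$; with $a = l/4$ the two terms of [cube_integral_le_power] are
    then equal and add up to the half level required by
    [tail_integral_le_variation].  The condition $l_0 \le l$ says that d does not
    exceed $d_0$, so that the cubes stay inside the balls. *)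
Lemma tail_integral_le (l : R) : l0 <= l ->
  (\int[mu]_(x in [set x | (l < `|u x|)%R]) `|u x|%:E <=
    (2 * n%:R * (d0 * (l0 / l) `^ (p / n%:R)) * V)%:E)%E.
Proof.
move=> l0l; have lgt0 : 0 < l by exact: lt_le_trans l0l.
have nR0 : n%:R != 0 :> R by rewrite pnatr_eq0 -lt0n.
have q0 : 0 < l0 / l by rewrite divr_gt0.
have pow0 : 0 < (l0 / l) `^ (p / n%:R) by rewrite powR_gt0.
set d := d0 * _; have dgt0 : 0 < d by rewrite mulr_gt0.
have powle1 : (l0 / l) `^ (p / n%:R) <= 1.
  rewrite -[leRHS](powRr0 (l0 / l)); apply: ger_powR.
    by rewrite q0/= ler_pdivrMr// mul1r.
  by rewrite divr_ge0 ?ler0n// (le_trans ler01).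
have dr : n%:R * d < r.
  by apply: le_lt_trans d0r; rewrite ler_wpM2l// /d ler_piMr// ltW.
apply: tail_integral_le_variation => // x.
have a0 : 0 < l / 4 by rewrite divr_gt0.
have := cube_integral_le_power _ dgt0 dr p1 a0 (uloc x);
  move/(_ (integrable_measurable iu)) => H.
apply: (le_trans H); rewrite lee_fin le_eqVlt; apply/orP; left; apply/eqP.
have dnE : d ^+ n = d0 ^+ n * (l0 / l) `^ p.
  by rewrite /d exprMn -[X in _ * X = _]powR_mulrn ?powR_ge0// -powRrM divfK.
have -> : l0 / 4 = (l0 / l) * (l / 4) by field; rewrite gt_eqF.
rewrite (@powRM _ (l0 / l) (l / 4)) ?(ltW q0) ?(ltW a0)// dnE.
have ap0 : (l / 4) `^ p != 0 by rewrite gt_eqF// powR_gt0.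
move: (d0 ^+ n) ((l0 / l) `^ p) ((l / 4) `^ p) ap0 => X Y Z Z0.
by field.
Qed.

Lemma dyadic_bracket (t : R) : l0 < t ->
  exists j : nat, 2 ^+ j * l0 < t <= 2 ^+ j.+1 * l0.
Proof.
move=> l0t; pose P m := t <= 2 ^+ m * l0.
have exP : exists m, P m.
  exists (Num.truncn (t / l0)).+1; rewrite /P -ler_pdivrMr//.
  apply: le_trans (ltW (truncnS_gt _)) _.
  by rewrite -natrX ler_nat ltnW// ltn_expl.
have [m Pm mmin] := ex_minnP exP.
case: m Pm mmin => [|j] Pm mmin.
  by move: Pm; rewrite /P expr0 mul1r leNgt l0t.
exists j; apply/andP; split; last exact: Pm.
by rewrite ltNge; apply/negP => /mmin; rewrite ltnn.
Qed.

(** Below the level $l_0$, $|u|^s \le l_0^{s-1} |u|$.  Above it, cut at the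
    levels $2^j l_0$: there $|u|^s$ is at most $(2^{j+1} l_0)^{s-1} |u|$, and the
    tail integrals decay like $2^{-jp/n}$.  The resulting series is geometric
    with ratio $2^{s-1-p/n}$, which is why s must stay below $1 + p/n$. *)
Lemma global_power_integral_le (s : R) : 1 < s -> s < 1 + p / n%:R ->
  (\int[mu]_x (`|u x| `^ s)%:E <=
    (l0 `^ (s - 1) * (A + 2 * n%:R * d0 * V * 2 `^ (s - 1) /
       (1 - 2 `^ (s - 1 - p / n%:R))))%:E)%E.
Proof.
move=> s1 sp.
set rho := 2 `^ (s - 1 - p / n%:R).
have rho0 : 0 < rho by rewrite powR_gt0.
have rho1 : rho < 1.
  have e0 : s - 1 - p / n%:R < 0 by rewrite subr_lt0 ltrBlDl.
  have ln2 : 0 < ln (2 : R) by rewrite ln_gt0// ltr1n.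
  by rewrite /rho /powR pnatr_eq0/= -[ltRHS]expR0 ltr_expR nmulr_rlt0.
set L := l0 `^ (s - 1); have L0 : 0 < L by rewrite powR_gt0.
pose l j := 2 ^+ j * l0.
have l_gt0 j : 0 < l j by rewrite mulr_gt0// exprn_gt0.
have l_ge j : l0 <= l j by rewrite ler_peMl ?(ltW l00)// exprn_ege1// ler1n.
pose E j : set 'rV[R]_n := [set x | l j < `|u x|].
have mu_ : measurable_fun setT (fun x => `|u x|).
  by apply: measurableT_comp => //; exact: (integrable_measurable iu).
have mE j : measurable (E j).
  rewrite (_ : E j = (fun x => `|u x|) @^-1` `]l j, +oo[%classic); last first.
    by apply/seteqP; split => x; rewrite /= in_itv/= andbT.
  by rewrite -[X in measurable X]setTI; apply: mu_ => //; exact: measurable_itv.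
have mus : measurable_fun setT (fun x => (`|u x| `^ s)%:E).
  apply/measurable_EFinP.
  by apply: (measurableT_comp (f := fun y => y `^ s)) => //; exact:
    measurable_powR.
pose f j x : \bar R := ((l j.+1 `^ (s - 1)) * (`|u x| * \1_(E j) x))%:E.
have f0 j x : (0 <= f j x)%E by rewrite lee_fin mulr_ge0 ?powR_ge0// mulr_ge0.
have mf j : measurable_fun setT (f j).
  apply/measurable_EFinP; apply: measurable_funM => //.
  by apply: measurable_funM => //; exact: measurable_indic.
have pointwise x :
    ((`|u x| `^ s)%:E <= (L * `|u x|)%:E + \sum_(0 <= j <oo) f j x)%E.
  have sE : `|u x| `^ s = `|u x| `^ (s - 1) * `|u x|.
    by rewrite mulrC mulr_powRB1// (lt_trans ltr01).
  have [ul|lu] := leP `|u x| l0.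
    apply: (@le_trans _ _ (L * `|u x|)%:E); last first.
      by rewrite leeDl// nneseries_ge0.
    rewrite lee_fin sE ler_wpM2r// ge0_ler_powR ?nnegrE ?(ltW l00)//; lra.
  have [j /andP[lj ju]] := dyadic_bracket lu.
  apply: (@le_trans _ _ (\sum_(0 <= i <oo) f i x)%E); last first.
    by rewrite leeDr// lee_fin mulr_ge0 ?(ltW L0).
  apply: (@le_trans _ _ (f j x)).
    rewrite lee_fin indicE mem_set// mulr1 sE ler_wpM2r//.
    rewrite ge0_ler_powR ?nnegrE ?(ltW (l_gt0 _))//; lra.
  apply: le_trans (nneseries_lim_ge j.+1 _); last by move=> *; exact: f0.
  by rewrite big_nat_recr//= leeDr// sume_ge0.
have If j : (\int[mu]_x f j x <=
    (L * (2 * n%:R * d0 * V * 2 `^ (s - 1)) * rho ^+ j)%:E)%E.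
  rewrite /f; under eq_integral do rewrite EFinM.
  rewrite ge0_integralZl//; last 2 first.
  - by apply/measurable_EFinP; apply: measurable_funM => //; exact:
      measurable_indic.
  - by rewrite lee_fin powR_ge0.
  have -> : (\int[mu]_x (`|u x| * \1_(E j) x)%:E = \int[mu]_(x in E j) `|u
    x|%:E)%E.
    rewrite [RHS]integral_mkcond; apply: eq_integral => x _.
    by rewrite patchE indicE; case: (x \in E j); rewrite ?mulr1 ?mulr0.
  apply: (@le_trans _ _ ((l j.+1 `^ (s - 1))%:E *
      (2 * n%:R * (d0 * (l0 / l j) `^ (p / n%:R)) * V)%:E)%E).
    by apply: lee_wpmul2l; [rewrite lee_fin powR_ge0|exact: tail_integral_le].
  rewrite -EFinM lee_fin le_eqVlt; apply/orP; left; apply/eqP.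
  have -> : l0 / l j = (2 ^+ j)^-1.
    by rewrite /l invfM mulrCA divff ?mulr1// gt_eqF.
  have twoj a : (2 ^+ j) `^ a = (2 `^ a) ^+ j :> R.
    by rewrite -!powR_mulrn ?powR_ge0// -!powRrM mulrC.
  rewrite -[X in X `^ (p / _)]powR_inv1 ?exprn_ge0// -powRrM mulN1r powRN twoj.
  rewrite /l powRM ?exprn_ge0 ?(ltW l00)// exprS powRM ?exprn_ge0// twoj -/L.
  rewrite /rho (@powRB _ 2 (s - 1) (p / n%:R)) ?pnatr_eq0 ?implybT// expr_div_n.
  have : (2 `^ (p / n%:R)) ^+ j != 0 :> R by rewrite expf_neq0// gt_eqF//
    powR_gt0.
  by move=> h; field.
apply: (@le_trans _ _ (\int[mu]_x ((L * `|u x|)%:E + \sum_(0 <= j <oo) f j x))%E).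
  apply: ge0_le_integral => //.
  apply: emeasurable_funD; first by apply/measurable_EFinP; exact:
    measurable_funM.
  exact: ge0_emeasurable_sum.
rewrite ge0_integralD//; last 4 first.
- by move=> x _; rewrite lee_fin mulr_ge0 ?(ltW L0).
- by apply/measurable_EFinP; exact: measurable_funM.
- by move=> x _; exact: nneseries_ge0.
- exact: ge0_emeasurable_sum.
rewrite mulrDr EFinD; apply: leeD.
  under eq_integral do rewrite EFinM.
  rewrite ge0_integralZl//; last 2 first.
  - exact/measurable_EFinP.
  - by rewrite lee_fin ltW.
  by rewrite EFinM; apply: lee_wpmul2l => //; rewrite lee_fin ltW.
rewrite integral_nneseries//.
apply: lime_le.
  by apply: is_cvg_nneseries => j _ _; exact: integral_ge0.
apply: nearW => m.
apply: (@le_trans _ _ (\sum_(0 <= j < m) (L * (2 * n%:R * d0 * V * 2 `^ (s -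
  1)) * rho ^+ j)%:E)%E).
  exact: lee_sum.
rewrite sumEFin lee_fin [leRHS]mulrA.
apply: geometric_le_lim => //; last by rewrite ger0_norm// ltW.
by rewrite !mulr_ge0 ?powR_ge0 ?(ltW L0) ?(ltW d00).
Qed.

End global_power_integral_le.

(** * Iterating the gain of integrability *)

Section bootstrap.
Context {R : realType}.

(** Write t for the critical exponent.  Since $t = 1 + t/N$, the exponent s is
    reachable from p as soon as $t - p < N (t - s)$.  As N is at least 2, going
    back from s the distance to t can be multiplied by 3/2 at every step, until
    q is reached.  P stands for a local property, G for the global one that
    implies it. *)
Lemma exponent_bootstrap (N : nat) (q : R) (P G : R -> Prop) : (2 <= N)%N ->
  1 <= q -> q < Sobolev_exponent R N -> P q ->
  (forall p s, 1 <= p -> P p -> 1 < s -> s < 1 + p / N%:R -> G s) ->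
  (forall s, 1 <= s -> G s -> P s) ->
  forall s, 1 < s -> s < Sobolev_exponent R N -> G s.
Proof.
move=> N2 q1; set t := Sobolev_exponent R N => qt Pq step GP.
have N2R : 2 <= N%:R :> R by rewrite ler_nat.
pose i : R := N%:R^-1.
have i0 : 0 < i by rewrite invr_gt0; lra.
have i2 : i <= 1 / 2 by rewrite /i -div1r ler_pdivrMr; lra.
have tE : t = 1 + t * i.
  rewrite /t /Sobolev_exponent /i; field.
  by apply/andP; split; rewrite gt_eqF//; lra.
have qlt : q < 1 + q * i by nra.
(* Enlarged k times by 3/2, the distance of s to t is at least that of q. *)
suff H k : forall s, 1 < s -> s < t -> t - q <= (3 / 2) ^+ k * (t - s) -> G s.
  move=> s s1 st.
  pose k := (Num.truncn (2 * (t - q) / (t - s))).+1.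
  apply: (H k) => //.
  have ts0 : 0 < t - s by rewrite subr_gt0.
  (* Bernoulli's inequality makes such a k explicit. *)
  have bern : 1 + k%:R / 2 <= (3 / 2) ^+ k :> R.
    elim: k => [|m IH]; first by rewrite expr0; lra.
    rewrite exprS -natr1; have : 0 <= m%:R :> R by [].
    by nra.
  have : 2 * (t - q) / (t - s) < k%:R by exact: truncnS_gt.
  rewrite ltr_pdivrMr// => hk.
  by nra.
elim: k => [|k IH] s s1 st hk.
  apply: (step q) => //; move: hk; rewrite expr0 -/i; nra.
have [s'1|s'1] := leP (t - 3 / 2 * (t - s)) 1.
  by apply: (step q) => //; rewrite -/i; nra.
apply: (step (t - 3 / 2 * (t - s))) => //.
- exact: ltW.
- apply: GP; first exact: ltW.
  apply: IH => //; first by lra.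
  by move: hk; rewrite exprS; lra.
- by rewrite -/i; nra.
Qed.

End bootstrap.

Section vanishing.
Context {R : realType} {n : nat}.
Local Notation mu := (@lebesgue_rV R n).
Hypothesis n0 : (0 < n)%N.

Lemma total_variation_ge0 (u : 'rV[R]_n -> R) : (0 <= total_variation u)%E.
Proof.
(* The zero field is admissible. *)
pose i : 'I_n := Ordinal n0.
apply: ereal_sup_ubound => /=.
exists (fun x => (fun=> 0) x *: delta_mx ord0 i).
  split; first by apply: (@C1c_field R n (fun=> 0) i 0) => //; exact: C1_cst.
  by move=> x; rewrite enorm_field normr0 ler01.
rewrite (eq_integral (cst 0%E)) ?integral0// => x _.
by rewrite divergence_field derive_cst mulr0.
Qed.

Lemma BV_norm_bounds (u : 'rV[R]_n -> R) (M : R) : (BV_norm u <= M%:E)%E ->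
  (total_variation u <= M%:E)%E /\ (\int[mu]_x `|u x|%:E <= M%:E)%E.
Proof.
have i0 : (0 <= \int[mu]_x `|u x|%:E)%E by exact: integral_ge0.
have t0 := total_variation_ge0 u.
by rewrite /BV_norm => h; split; apply: le_trans h; rewrite ?leeDl ?leeDr.
Qed.

Lemma local_le_global (u : 'rV[R]_n -> R) (s r : R) y : measurable_fun setT u ->
  (\int[mu]_(x in eball y r) (`|u x| `^ s)%:E <= \int[mu]_x (`|u x| `^ s)%:E)%E.
Proof.
move=> mu_; apply: ge0_subset_integral => //; first exact: measurable_eball.
apply/measurable_EFinP.
apply: (measurableT_comp (f := fun y => y `^ s)); first exact: measurable_powR.
exact: measurableT_comp.
Qed.

Lemma cube_side_exists (r : R) : 0 < r -> exists2 d : R, 0 < d & n%:R * d < r.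
Proof.
move=> r0; exists (r / n.+1%:R); first by rewrite divr_gt0// ltr0n.
rewrite mulrCA gtr_pMr// ltr_pdivrMr ?ltr0n// mul1r ltr_nat.
exact: ltnSn.
Qed.

(** The level $l_0 = 4b$ only has to be large enough to absorb the constant C;
    here $b^p \ge b$ because b is at least 1. *)
Lemma power_integral_finite (u : 'rV[R]_n -> R) (M p s : R) (r : R) :
  0 < r -> mu.-integrable setT (EFin \o u) -> (BV_norm u <= M%:E)%E -> 1 <= p ->
  (exists C : R, forall y, (\int[mu]_(x in eball y r) (`|u x| `^ p)%:E <=
    C%:E)%E) ->
  1 < s -> s < 1 + p / n%:R ->
  (\int[mu]_x (`|u x| `^ s)%:E < +oo)%E.
Proof.
move=> r0 iu /BV_norm_bounds[uV uA] p1 [C uC] s1 sp.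
have V0 : 0 <= M by rewrite -lee_fin (le_trans (total_variation_ge0 u)).
have [d d0 dr] := cube_side_exists r0.
have dn0 : 0 < d ^+ n by rewrite exprn_gt0.
pose b := 1 + `|C| / d ^+ n.
have b1 : 1 <= b by rewrite lerDl divr_ge0// ltW.
have b40 : 0 < 4 * b by lra.
have uloc y : (\int[mu]_(x in eball y r) (`|u x| `^ p)%:E <=
    (d ^+ n * (4 * b / 4) `^ p)%:E)%E.
  apply: le_trans (uC y) _; rewrite lee_fin [4 * b]mulrC mulfK ?pnatr_eq0//.
  apply: (@le_trans _ _ (d ^+ n * b)); last by rewrite ler_wpM2l ?(ltW dn0)//
    le1r_powR.
  rewrite /b mulrDr mulr1 mulrCA divff ?gt_eqF// mulr1.
  by apply: le_trans (ler_norm _) _; rewrite lerDr ltW.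
apply: le_lt_trans (global_power_integral_le n0 iu V0 uV uA d0 dr p1 b40 uloc
  s1 sp) _.
exact: ltry.
Qed.

(** The level b is chosen first, so that the constant produced by
    [global_power_integral_le] is at most e; the local integrals are eventually
    below the threshold attached to b. *)
Lemma power_integral_vanishing (u : nat -> 'rV[R]_n -> R) (M p s r : R) :
  0 < r -> (forall k, mu.-integrable setT (EFin \o u k)) ->
  (forall k, (BV_norm (u k) <= M%:E)%E) -> 1 <= p ->
  (forall e : R, 0 < e -> \forall k \near \oo, forall y,
    (\int[mu]_(x in eball y r) (`|u k x| `^ p)%:E <= e%:E)%E) ->
  1 < s -> s < 1 + p / n%:R ->
  forall e : R, 0 < e -> \forall k \near \oo,
    (\int[mu]_x (`|u k x| `^ s)%:E <= e%:E)%E.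
Proof.
move=> r0 iu uM p1 uloc s1 sp e e0.
have V0 : 0 <= M.
  have [h _] := BV_norm_bounds (uM 0%N).
  by rewrite -lee_fin (le_trans (total_variation_ge0 (u 0%N))).
have [d d0 dr] := cube_side_exists r0.
have dn0 : 0 < d ^+ n by rewrite exprn_gt0.
have s10 : 0 < s - 1 by rewrite subr_gt0.
set K := M + 2 * n%:R * d * M * 2 `^ (s - 1) / (1 - 2 `^ (s - 1 - p / n%:R)).
pose b := (e / (1 + `|K|)) `^ (s - 1)^-1.
have K0 : 0 < 1 + `|K| by rewrite ltr_pwDl.
have eK0 : 0 < e / (1 + `|K|) by rewrite divr_gt0.
have b0 : 0 < b by rewrite powR_gt0.
have c0 : 0 < d ^+ n * (b / 4) `^ p by rewrite mulr_gt0// powR_gt0// divr_gt0.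
apply: filterS (uloc _ c0) => k ulock.
have [uV uA] := BV_norm_bounds (uM k).
apply: le_trans (global_power_integral_le n0 (iu k) V0 uV uA d0 dr p1 b0 ulock
  s1 sp) _.
rewrite lee_fin -/K /b -powRrM mulVf ?gt_eqF// powRr1 ?(ltW eK0)//.
rewrite mulrAC ler_pdivrMr// ler_wpM2l ?(ltW e0)//.
by apply: le_trans (ler_norm _) _; rewrite lerDr.
Qed.

Lemma Lnorm_powR (f : 'rV[R]_n -> R) (s : R) :
  'N[mu]_(s%:E)[EFin \o f]%E = ((\int[mu]_x (`|f x| `^ s)%:E) `^ s^-1)%E.
Proof. by rewrite unlock; congr (_ `^ _)%E; apply: eq_integral. Qed.

Lemma Lp_cvg0_of_integral (u : nat -> 'rV[R]_n -> R) (s : R) : 0 < s ->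
  (forall k, measurable_fun setT (u k)) ->
  (forall k, (\int[mu]_x (`|u k x| `^ s)%:E < +oo)%E) ->
  (forall e : R, 0 < e -> \forall k \near \oo,
    (\int[mu]_x (`|u k x| `^ s)%:E <= e%:E)%E) ->
  Lp_cvg0 s u.
Proof.
move=> s0 mu_ fin small; split=> [k|].
  apply/andP; split; first by rewrite inE; exact: mu_.
  by rewrite inE /= /finite_norm Lnorm_powR poweR_lty.
have smallN (e : R) : 0 < e -> \forall k \near \oo,
  ('N[mu]_(s%:E)[EFin \o u k] <= e%:E)%E.
  move=> e0; have es0 : 0 < e `^ s by rewrite powR_gt0.
  apply: filterS (small _ es0) => k h; rewrite Lnorm_powR.
  have -> : e%:E = ((e `^ s)%:E `^ s^-1)%E.
    by rewrite poweR_EFin -powRrM mulfV ?gt_eqF// powRr1 ?ltW.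
  apply: gt0_ler_poweR => //; first by rewrite invr_ge0 ltW.
    by rewrite in_itv/= leey andbT integral_ge0// => x _;
      rewrite lee_fin powR_ge0.
  by rewrite in_itv/= leey andbT lee_fin powR_ge0.
apply/fine_cvgP; split.
  apply: filterS (smallN _ ltr01) => k h; rewrite ge0_fin_numE ?Lnorm_ge0//.
  by apply: le_lt_trans h _; rewrite ltry.
apply/cvgrPdist_le => e e0; apply: filterS (smallN _ e0) => k h.
rewrite /= sub0r normrN ger0_norm ?fine_ge0 ?Lnorm_ge0//.
by rewrite -lee_fin fineK// ge0_fin_numE ?Lnorm_ge0// (le_lt_trans h)// ltry.
Qed.

End vanishing.

Theorem theorem1p1 (R : realType) (N : nat) (hN : (2 <= N)%N)
    (r q : R) (u : nat -> 'rV[R]_N -> R)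
    (hr : 0 < r)
    (hq1 : 1 <= q) (hq : q < Sobolev_exponent R N)
    (huBV : forall n, BV (u n))
    (hubnd : exists M : R, forall n, (BV_norm (u n) <= M%:E)%E)
    (hvanish :
      ereal_sup [set (\int[lebesgue_rV N]_(x in eball y r)
                        (`|u n x| `^ q)%:E)%E | y in [set: 'rV[R]_N]]
        @[n --> \oo] --> 0%E) :
  forall s : R, 1 < s -> s < Sobolev_exponent R N -> Lp_cvg0 s u.
Proof.
have N0 : (0 < N)%N by exact: leq_trans hN.
have [M uM] := hubnd.
have iu k : (lebesgue_rV N).-integrable setT (EFin \o u k).
  by apply/Lfun1_integrable; have [] := huBV k.
have mu_ k : measurable_fun setT (u k) by exact: integrable_measurable (iu k).
move=> s s1 st; apply: Lp_cvg0_of_integral => //; first by lra.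
- move=> k.
  (* Membership in the space: finiteness propagates from the exponent 1. *)
  pose P p := exists C : R, forall y,
    (\int[lebesgue_rV N]_(x in eball y r) (`|u k x| `^ p)%:E <= C%:E)%E.
  pose G p := (\int[lebesgue_rV N]_x (`|u k x| `^ p)%:E < +oo)%E.
  apply: (@exponent_bootstrap R N 1 P G) => //.
  + exact: le_lt_trans hq1 hq.
  + exists M => y; apply: le_trans (local_le_global _ _ _ (mu_ k)) _.
    under eq_integral do rewrite powRr1//.
    exact: (BV_norm_bounds N0 (uM k)).2.
  + by move=> p s' p1 Pp s'1 s'p; exact:
      power_integral_finite (uM k) p1 Pp s'1 s'p.
  + move=> s' s'1 Gs'; exists (fine (\int[lebesgue_rV N]_x (`|u k x| `^
      s')%:E)) => y.
    rewrite fineK; first exact: local_le_global.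
    by rewrite ge0_fin_numE// integral_ge0// => x _; rewrite lee_fin powR_ge0.
- (* Convergence: smallness propagates from the exponent q. *)
  pose P p := forall e : R, 0 < e -> \forall k \near \oo, forall y,
    (\int[lebesgue_rV N]_(x in eball y r) (`|u k x| `^ p)%:E <= e%:E)%E.
  pose G p := forall e : R, 0 < e -> \forall k \near \oo,
    (\int[lebesgue_rV N]_x (`|u k x| `^ p)%:E <= e%:E)%E.
  apply: (@exponent_bootstrap R N q P G) => //.
  + move=> e e0; have e0E : (0 < e%:E)%E by rewrite lte_fin.
    have [m _ hm] := hvanish _ (open_ereal_lt' e0E).
    exists m => // k mk y; have /ltW h := hm k mk.
    by apply: le_trans h; apply: ereal_sup_ubound; exists y.
  + by move=> p s' p1 Pp s'1 s'p; exact: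
      power_integral_vanishing uM p1 Pp s'1 s'p.
  + move=> s' s'1 Gs' e e0; apply: filterS (Gs' e e0) => k h y.
    by apply: le_trans h; exact: local_le_global.
Qed.
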